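(* The Kempf-Ness set $\mathcal M$ of $X$ is given by $$\mathcal M=\{\exp(\xi)u\mid u\in X_0,\ \xi\in\mathcal S_u\cap\mathfrak r_0\}.$$
   Context: Setting: $U$ is a compact connected Lie group with complexification $U_{\mathbb C}$ and Lie algebra $\mathfrak u$; $\varphi$ is an antiholomorphic involutive automorphism of $U_{\mathbb C}$ preserving $U$, and $G\subset U_{\mathbb C}$ is the corresponding real form (the fixed group of $\varphi$). $\sigma,\theta$ are holomorphic involutive automorphisms of $U_{\mathbb C}$ commuting with $\varphi$ and generating a finite group of automorphisms of the identity component of the center of $U_{\mathbb C}$. $H$ is an open subgroup of $G^\sigma$ and $K=G^\theta$; it is assumed that $G=HG^0K$, where $G^0$ is the identity component. $\delta$ is the Cartan involution of $U_{\mathbb C}$ with fixed group $U$; it is assumed to commute with $\sigma,\theta,\varphi$. Induced maps on Lie algebras are denoted by the same letters. $\mathfrak g$ and $\mathfrak h$ are the Lie algebras of $G$ and $H$, $\mathfrak g=\mathfrak g_0\oplus\mathfrak r_0$ is the decomposition into $+1$ and $-1$ eigenspaces of $\delta$, and $G_0=G\cap U$. The group $G$ acts on itself by $g*x=gx\theta(g)^{-1}$; $\beta(g)=g*e$, $X=\beta(G)$, $X_0=\beta(G_0)$. For $u\in X$ put $\theta_u=\operatorname{conj}(u)\circ\theta$ and $\mathcal S_u=\{Z\in\mathfrak g\mid\theta_u(Z)=\sigma(Z)=-Z\}$. Kempf-Ness set: let $\langle\ ,\ \rangle$ be an inner product on $\mathfrak u$ invariant under $U$ (adjoint action), $\sigma$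 and $\theta$. Define $\rho:U_{\mathbb C}\to\mathbb R$ by $\rho(u\exp(i\eta))=\tfrac12\langle\eta,\eta\rangle$ for $u\in U$, $\eta\in\mathfrak u$ (Cartan decomposition $U_{\mathbb C}=U\exp(i\mathfrak u)$). For $x\in X$ let $\mu(x)\in(i\mathfrak h\cap\mathfrak u)^*$ be given by $\mu(x)(\xi)=\frac{d}{dt}\big|_{t=0}\rho\big(\exp(it\xi)\,x\,\exp(-it\theta(\xi))\big)$ for $\xi\in i\mathfrak h\cap\mathfrak u$. Then $\mathcal M=\{x\in X\mid\mu(x)=0\}$. *)

(* Defs.v *)
From HB Require Import structures.
From mathcomp Require Import all_boot all_order all_algebra.
From mathcomp Require Import complex.
From mathcomp Require Import all_classical all_reals all_analysis.

Set Implicit Arguments.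
Unset Strict Implicit.
Unset Printing Implicit Defensive.

Import Order.TTheory GRing.Theory Num.Theory.
Import numFieldNormedType.Exports.

Local Open Scope classical_set_scope.
Local Open Scope complex_scope.
Local Open Scope ring_scope.

(* The complex field bundled as a numClosedFieldType, so that the topological
   and normed structures on 'rV[Cplx R]_n are found. *)
Definition Cplx (R : realType) : numClosedFieldType := R[i].

Definition real_scale (R : realType) (V : lmodType (Cplx R)) (t : R) (v : V) :
  V := (t%:C : Cplx R) *: v.
Notation "t *:_R v" := (real_scale t v)
  (at level 40, format "t  *:_R  v") : ring_scope.

(* Complex manifolds are given by an atlas of charts; a chart is stored as a
   pair of total functions, only meaningful on [cdom] and on its image. *)
Section Charts.
Variable R : realType.
Implicit Types E F : normedModType (Cplx R).
Implicit Types M N : topologicalType.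

Record chart E M := Chart { cdom : set M; cfwd : M -> E; cbwd : E -> M }.

Definition is_chart E M (c : chart E M) : Prop :=
  [/\ open (cdom c),
      open (cfwd c @` cdom c),
      forall x, cdom c x -> cbwd c (cfwd c x) = x,
      {within cdom c, continuous (cfwd c)} &
      {within cfwd c @` cdom c, continuous (cbwd c)}].

(* Holomorphic means C^1 with complex-linear differential: [differentiable]
   over the field [Cplx R] is complex Frechet differentiability. *)
Definition holomorphic_on E F (D : set E) (f : E -> F) : Prop :=
  forall x, D x ->
    differentiable f x /\ forall v, {for x, continuous (fun y => 'd f y v)}.

Definition transition_dom E F M N (a : chart E M) (b : chart F N) (f : M -> N)
    : set E :=
  cfwd a @` (cdom a `&` f @^-1` cdom b).

Definition holomorphic E F M N (A : set (chart E M)) (B : set (chart F N))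
    (f : M -> N) : Prop :=
  continuous f /\
  forall a b, A a -> B b ->
    holomorphic_on (transition_dom a b f) (cfwd b \o f \o cbwd a).

Definition is_atlas E M (A : set (chart E M)) : Prop :=
  [/\ forall c, A c -> is_chart c,
      forall x, exists2 c, A c & cdom c x &
      holomorphic A A (@id M)].

Definition vect_atlas E : set (chart E E) := [set Chart setT id id].

Definition prod_chart E F M N (a : chart E M) (b : chart F N)
    : chart (E * F)%type (M * N)%type :=
  Chart (cdom a `*` cdom b)
        (fun p => (cfwd a p.1, cfwd b p.2))
        (fun q => (cbwd a q.1, cbwd b q.2)).

Definition prod_atlas E F M N (A : set (chart E M)) (B : set (chart F N))
    : set (chart (E * F)%type (M * N)%type) :=
  [set c | exists a b, [/\ A a, B b & c = prod_chart a b]].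

(* The charts of the complex conjugate manifold. *)
Definition conj_atlas n M (A : set (chart 'rV[Cplx R]_n M))
    : set (chart 'rV[Cplx R]_n M) :=
  [set Chart (cdom c) (fun x => map_mx Num.conj (cfwd c x))
                      (fun z => cbwd c (map_mx Num.conj z)) | c in A].

Definition antiholomorphic n m M N (A : set (chart 'rV[Cplx R]_n M))
    (B : set (chart 'rV[Cplx R]_m N)) (f : M -> N) : Prop :=
  holomorphic A (conj_atlas B) f.

End Charts.

(* [chart1] is a preferred chart at the identity; it identifies the tangent
   space at the identity, i.e. the Lie algebra, with 'rV[Cplx R]_n. *)
HB.mixin Record isComplexLieGroup (R : realType) (n : nat) G
    of Topological G & Group G := {
  atlas : set (chart 'rV[Cplx R]_n G);
  atlasP : is_atlas atlas;
  chart1 : chart 'rV[Cplx R]_n G;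
  chart1_atlas : atlas chart1;
  chart1_dom : cdom chart1 (1%g : G);
  lie_hausdorff : hausdorff_space G;
  lie_second_countable : @second_countable G;
  lie_mul_holo :
    holomorphic (prod_atlas atlas atlas) atlas (fun p : G * G => (p.1 * p.2)%g);
  lie_inv_holo : holomorphic atlas atlas (fun x : G => (x^-1)%g) }.

#[short(type="complexLieGroupType")]
HB.structure Definition ComplexLieGroup (R : realType) (n : nat) :=
  { G of Topological G & Group G & isComplexLieGroup R n G }.

Section LieGroups.
Variables (R : realType) (n : nat) (G : complexLieGroupType R n).
Local Notation V := 'rV[Cplx R]_n.
Local Notation atl := (@atlas R n G).
Local Notation c1 := (@chart1 R n G).
Implicit Types (S U : set G) (f : G -> G) (X Y Z : V) (e : V -> G).

Definition subgroup S : Prop :=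
  [/\ S 1%g, forall x y, S x -> S y -> S (x * y)%g &
      forall x, S x -> S (x^-1)%g].

Definition group_morphism (G1 G2 : groupType) (f : G1 -> G2) : Prop :=
  {morph f : x y / (x * y)%g}.

Definition involutive_automorphism f : Prop :=
  involutive f /\ group_morphism f.

Definition fixed f : set G := [set x | f x = x].

(* Difference quotient at 0 of a curve through the identity. *)
Definition curve_quotient (g : R -> G) (t : R) : V :=
  t^-1 *:_R (cfwd c1 (g t) - cfwd c1 (g 0)).

Definition has_velocity (g : R -> G) X : Prop :=
  curve_quotient g t @[t --> 0^'] --> X.

(* The induced map on the Lie algebra: the differential at the identity, taken
   along real lines so that it also makes sense for antiholomorphic maps. *)
Definition lie_map f X : V :=
  lim (curve_quotient (fun t => f (cbwd c1 (cfwd c1 1%g + t *:_R X)))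
         t @[t --> 0^']).

Definition conj_by (u x : G) : G := (u * x * u^-1)%g.

Definition Ad (u : G) : V -> V := lie_map (conj_by u).

Definition is_exponential e : Prop :=
  [/\ holomorphic (@vect_atlas R V) atl e,
      forall X (s t : R),
        e ((s + t) *:_R X) = (e (s *:_R X) * e (t *:_R X))%g &
      forall X, has_velocity (fun t => e (t *:_R X)) X].

Definition Lie e S : set V := [set X | forall t : R, S (e (t *:_R X))].

Definition identity_component S : set G := connected_component S 1%g.

Definition group_center : set G := [set z | forall x : G, (z * x)%g = (x * z)%g].

(* For involutive s and t this is the group generated by s and t. *)
Inductive generated (s t : G -> G) : (G -> G) -> Prop :=
  | generated_id : generated s t id
  | generated_l f : generated s t f -> generated s t (s \o f)
  | generated_r f : generated s t f -> generated s t (t \o f).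

Definition generate_finite_group_on S (s t : G -> G) : Prop :=
  finite_set [set (fun z : S => f (val z)) | f in generated s t].

(* Universal property; continuous morphisms of Lie groups are automatically
   smooth. *)
Definition is_complexification U : Prop :=
  forall (m : nat) (L : complexLieGroupType R m) (f : G -> L),
    {within U, continuous f} ->
    (forall x y, U x -> U y -> f (x * y)%g = (f x * f y)%g) ->
    exists! F : G -> L,
      [/\ holomorphic atl (@atlas R m L) F,
          group_morphism F &
          forall x, U x -> F x = f x].

(* (k, X) |-> k exp(iX) is a homeomorphism from U x Lie(U) onto G. *)
Definition cartan_decomposition e U : Prop :=
  exists (k : G -> G) (p : G -> V),
    [/\ continuous k, continuous p,
        forall x, [/\ U (k x), Lie e U (p x) & x = (k x * e ('i *: p x))%g] &
        forall u X, U u -> Lie e U X ->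
          k (u * e ('i *: X))%g = u /\ p (u * e ('i *: X))%g = X].

Definition inner_product_on (W : set V) (ip : V -> V -> R) : Prop :=
  [/\ forall (a : R) X Y Z, W X -> W Y -> W Z ->
        ip (a *:_R X + Y) Z = a * ip X Z + ip Y Z,
      forall X Y, W X -> W Y -> ip X Y = ip Y X &
      forall X, W X -> X != 0 -> 0 < ip X X].

Definition invariant_on (W : set V) (ip : V -> V -> R) (a : V -> V) : Prop :=
  forall X Y, W X -> W Y -> ip (a X) (a Y) = ip X Y.

Definition rho e U (ip : V -> V -> R) (x : G) : R :=
  let X := get [set X | Lie e U X /\
                        exists2 u, U u & x = (u * e ('i *: X))%g] in
  2^-1 * ip X X.

Definition twisted_act (theta : G -> G) (g x : G) : G :=
  (g * x * (theta g)^-1)%g.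

Definition beta_image (theta : G -> G) S : set G :=
  [set twisted_act theta g 1%g | g in S].

Definition moment e U ip (theta : G -> G) (x : G) (xi : V) : R :=
  derive1 (fun t : R =>
     rho e U ip (e (t *:_R ('i *: xi)) * x *
                 e (- (t *:_R ('i *: lie_map theta xi))))%g) 0.

Definition i_Lie_meet e (H U : set G) : set V :=
  [set 'i *: Z | Z in Lie e H] `&` Lie e U.

Definition kempf_ness e U ip (theta : G -> G) (H X : set G) : set G :=
  [set x | X x /\
     forall xi, i_Lie_meet e H U xi -> moment e U ip theta x xi = 0].

Definition minus_space e (GR : set G) (sigma theta : G -> G) (u : G) : set V :=
  [set Z | [/\ Lie e GR Z, lie_map (conj_by u \o theta) Z = - Z &
               lie_map sigma Z = - Z]].

Definition r0 e (GR : set G) (delta : G -> G) : set V :=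
  [set Z | Lie e GR Z /\ lie_map delta Z = - Z].

End LieGroups.

(* Main.v *)
Require Import Defs.
From mathcomp Require Import all_boot all_order all_algebra.
From mathcomp Require Import complex.
From mathcomp Require Import all_classical all_reals all_analysis.
From mathcomp Require Import ring lra.
Import Order.TTheory GRing.Theory Num.Theory.
Import numFieldNormedType.Exports.
Local Open Scope classical_set_scope.
Local Open Scope complex_scope.
Local Open Scope ring_scope.
Set Implicit Arguments.
Unset Strict Implicit.

(** Why the theorem holds.  Let [p(y)] in [u] denote the noncompact component of
    [y = k exp(i p(y))] in the Cartan decomposition, so that
    [rho(y) = <p(y), p(y)> / 2].  For [x = k exp(i eta)] and
    [g_t = exp(it zeta) x exp(-it zeta')] one has, at [t = 0],

      [d/dt rho(g_t) = <Ad(k^-1) zeta, eta> - <zeta', eta>]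

    ([rho_derivative]).  When [x] is in [X] we have [theta(x) = x^-1] and
    [phi(x) = x], and uniqueness in the Cartan decomposition turns this into
    [theta(k) = k^-1], [theta(eta) = - Ad(k) eta], [phi(k) = k] and
    [phi(eta) = - eta].  Hence [x = exp(xi) k] with [xi = i eta'],
    [eta' = Ad(k) eta], [theta_k(xi) = - xi], [xi] in [r_0], and for
    [zeta' = theta(zeta)] the two terms of the derivative agree:
    [mu(x)(zeta) = 2 <zeta, eta'>] ([moment_value]).  The vector
    [zeta = eta' + sigma(eta')] is an admissible argument of [mu(x)], and by
    [sigma]-invariance [<zeta, zeta> = 2 <zeta, eta'>]; so [mu(x) = 0] forces
    [sigma(xi) = - xi], and the converse is orthogonality of the two
    eigenspaces of [sigma].  Finally [k = exp(-xi/2) * x] for the twisted action,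
    so [k] is in the intersection of [X] and [U], which is [X_0] by uniqueness
    once more ([twist_shift], [twist_compact]).

    The derivative of [rho].  Since [delta] fixes [U] and inverts [exp(iu)],
    [delta(y)^-1 y = exp(2i p(y))].  Thus [v_t = 2i p(g_t)] is a continuous lift
    through [exp] of an explicit product of one-parameter groups
    ([velocity_polar]).  Let [J_X] be the left logarithmic differential of [exp].

    - The lift is differentiable because [J_X] is injective for [X] in [iu]
      ([dexp_inj], [exp_lift]).  Indeed [J_{2X}(2Y) = (1 + Ad(exp(-X))) J_X(Y)], and
      [-1] is not an eigenvalue of [Ad(exp(i eta))]: an eigenvector could be chosen
      in [u], and then one group element would have two Cartan decompositions
      ([no_inversion]).  So a zero of [J_X] is a zero of [J] at [X/2^k] for every [k],
      while [J_0] is the identity.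

    - The value of the derivative needs [<J_X Y, eta> = <Y, eta>] and
      [<Ad(exp(X)) Y, eta> = <Y, eta>] for [X] a complex multiple of [eta].  Both
      are instances of [invariant_functional]: an endomorphism that commutes with
      the unitary group [Ad(exp(t eta))] and is the identity on its fixed vectors
      preserves the functional [<., eta>].

    Both arguments use first derivatives of the group law only: commutation in the
    group takes the place of vanishing brackets. *)

(** * Linear algebra over the reals inside complex modules *)

Section RealScale.
Variables (R : realType) (V : lmodType (Cplx R)).
Implicit Types (s t : R) (u v : V).

Lemma rscale0 v : (0 : R) *:_R v = 0. Proof. exact: scale0r. Qed.
Lemma rscaler0 t : t *:_R (0 : V) = 0. Proof. exact: scaler0. Qed.
Lemma rscale1 v : (1 : R) *:_R v = v. Proof. exact: scale1r. Qed.
Lemma rscaleA s t v : s *:_R (t *:_R v) = (s * t) *:_R v.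
Proof. by rewrite /real_scale scalerA -rmorphM. Qed.
Lemma rscalerD t u v : t *:_R (u + v) = t *:_R u + t *:_R v.
Proof. exact: scalerDr. Qed.
Lemma rscalerB t u v : t *:_R (u - v) = t *:_R u - t *:_R v.
Proof. exact: scalerBr. Qed.
Lemma rscaleD s t v : (s + t) *:_R v = s *:_R v + t *:_R v.
Proof. by rewrite /real_scale -scalerDl -rmorphD. Qed.
Lemma rscaleN t v : (- t) *:_R v = - (t *:_R v).
Proof. by rewrite /real_scale -scaleNr -rmorphN. Qed.
Lemma rscalerN t v : t *:_R (- v) = - (t *:_R v).
Proof. exact: scalerN. Qed.
Lemma rscaleC t (c : Cplx R) v : t *:_R (c *: v) = c *: (t *:_R v).
Proof. by rewrite /real_scale !scalerA mulrC. Qed.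
Lemma rscaleVK t v : t != 0 -> t *:_R (t^-1 *:_R v) = v.
Proof. by move=> t0; rewrite rscaleA mulfV // rscale1. Qed.
Lemma rscaleKV t v : t != 0 -> t^-1 *:_R (t *:_R v) = v.
Proof. by move=> t0; rewrite rscaleA mulVf // rscale1. Qed.

End RealScale.

Lemma linear_rscale (R : realType) (V W : lmodType (Cplx R)) (f : {linear V -> W}) (t : R) v :
  f (t *:_R v) = t *:_R f v.
Proof. exact: linearZ. Qed.

(** Linearity is kept as a property of plain functions, since the differentials
    below arise from existence statements. *)
Section LinearFacts.
Variables (R : realType) (V W : lmodType (Cplx R)) (L : V -> W).
Hypothesis lL : linear L.
Lemma lin0 : L 0 = 0.
Proof. by have := lL (-1) 0 0; rewrite scaler0 addr0 scaleN1r addNr. Qed.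
Lemma linZ k u : L (k *: u) = k *: L u.
Proof. by have := lL k u 0; rewrite !addr0 lin0 addr0. Qed.
Lemma linD u v : L (u + v) = L u + L v.
Proof. by have := lL 1 u v; rewrite !scale1r. Qed.
Lemma linN u : L (- u) = - L u.
Proof. by rewrite -scaleN1r linZ scaleN1r. Qed.
Lemma linB u v : L (u - v) = L u - L v.
Proof. by rewrite linD linN. Qed.
Lemma linR t u : L (t *:_R u) = t *:_R L u.
Proof. exact: linZ. Qed.

End LinearFacts.

Definition antilinear (R : realType) (V : lmodType (Cplx R)) (D : V -> V) : Prop :=
  forall k u v, D (k *: u + v) = Num.conj k *: D u + D v.

Section AntiLinear.
Variables (R : realType) (V : lmodType (Cplx R)) (D : V -> V).
Hypothesis aD : antilinear D.

Lemma antilin0 : D 0 = 0.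
Proof. by have := aD (-1) 0 0; rewrite scaler0 addr0 rmorphN1 scaleN1r addNr. Qed.
Lemma antilinZ k u : D (k *: u) = Num.conj k *: D u.
Proof. by have := aD k u 0; rewrite !addr0 antilin0 addr0. Qed.
Lemma antilinD u v : D (u + v) = D u + D v.
Proof. by have := aD 1 u v; rewrite rmorph1 !scale1r. Qed.
Lemma antilinN u : D (- u) = - D u.
Proof. by rewrite -scaleN1r antilinZ rmorphN1 scaleN1r. Qed.
Lemma antilinB u v : D (u - v) = D u - D v.
Proof. by rewrite antilinD antilinN. Qed.
Lemma conj_i : Num.conj ('i : Cplx R) = - 'i.
Proof. by apply/eqP; rewrite eq_complex /= oppr0 !eqxx. Qed.
Lemma antilin_i u : D ('i *: u) = - ('i *: D u).
Proof. by rewrite antilinZ conj_i scaleNr. Qed.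
Lemma antilinR t u : D (t *:_R u) = t *:_R D u.
Proof.
rewrite /real_scale antilinZ; congr (_ *: _).
by apply/eqP; rewrite eq_complex /= oppr0 !eqxx.
Qed.

End AntiLinear.

(** * Real curves in complex normed modules *)

Section Norms.
Variables (R : realType).

Lemma norm_realC (t : R) : `|t%:C : Cplx R| = (`|t|)%:C.
Proof. by rewrite [LHS]normc_def /= expr0n /= addr0 sqrtr_sqr. Qed.

Lemma norm_rscale (E : normedModType (Cplx R)) (t : R) (v : E) :
  `|t *:_R v| = (`|t|)%:C * `|v|.
Proof. by rewrite /real_scale normrZ norm_realC. Qed.

(** The norms of complex modules take values in the complex field, so that radii
    are positive complex numbers, that is, positive reals. *)
Lemma pos_complex (e : Cplx R) : 0 < e -> exists2 d : R, 0 < d & e = d%:C.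
Proof.
case: e => a b; rewrite ltcE /= => /andP[/eqP -> a0]; by exists a.
Qed.

Lemma cvg_realC (t : R) : (s%:C : Cplx R) @[s --> t] --> (t%:C : Cplx R).
Proof.
apply/cvgrPdist_lt => e /pos_complex[d d0 ->].
near=> s; rewrite -rmorphB norm_realC ltcR.
by near: s; apply: cvgr_dist_lt.
Unshelve. all: by end_near. Qed.

Lemma norm_Re_le (z : Cplx R) : (`|complex.Re z|)%:C <= `|z|.
Proof.
by rewrite normc_def lecR -sqrtr_sqr ler_wsqrtr // lerDl sqr_ge0.
Qed.

Definition ReC (z : Cplx R) : R := complex.Re z.

Lemma cvg_Re (z : Cplx R) : ReC y @[y --> z] --> ReC z.
Proof.
have FF : Filter (nbhs z) by exact: nbhs_filter.
apply/(@cvgrPdist_lt _ _ _ (nbhs z) FF) => e e0.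
have e1 : 0 < (e%:C : Cplx R) by rewrite ltcR.
have h := nbhsx_ballx z _ e1.
by apply: filterS h => y; rewrite /ReC -ltcR -raddfB; apply: le_lt_trans (norm_Re_le _).
Qed.

End Norms.

Section Curves.
Variables (R : realType).
Implicit Types (E F : normedModType (Cplx R)).

Definition diff_quot E (v : R -> E) (t : R) : E := t^-1 *:_R (v t - v 0).
(** The derivative at 0 of a curve with a real parameter in a complex normed
    module, in the shape used by [has_velocity]. *)
Definition has_der E (v : R -> E) (Y : E) : Prop := diff_quot v t @[t --> 0^'] --> Y.

Lemma cvg_rscale E (T : Type) (G : set_system T) {FG : Filter G}
    (s : T -> R) (v : T -> E) (t : R) (Y : E) :
  s x @[x --> G] --> t -> v x @[x --> G] --> Y -> (s x *:_R v x) @[x --> G] --> t *:_R Y.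
Proof.
move=> hs hv; rewrite /real_scale; apply: cvgZ => //.
apply: (@cvg_comp _ _ _ s (fun r => r%:C : Cplx R) _ _ _ hs); exact: cvg_realC.
Qed.

Lemma has_der_cvg E (v : R -> E) Y : has_der v Y -> v t @[t --> 0^'] --> v 0.
Proof.
move=> h.
have h2 : (t *:_R diff_quot v t + v 0) @[t --> 0^'] --> v 0.
  rewrite -[X in _ --> X]add0r -(rscale0 Y); apply: cvgD; last exact: cvg_cst.
  by apply: cvg_rscale => //; apply: nbhs_dnbhs.
apply: cvg_trans h2; apply: near_eq_cvg; near=> t.
by rewrite /diff_quot rscaleVK ?subrK //; near: t; exact: nbhs_dnbhs_neq.
Unshelve. all: by end_near. Qed.

Lemma has_der_unique E (v : R -> E) Y Z : has_der v Y -> has_der v Z -> Y = Z.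
Proof. by move=> h1 h2; apply: cvg_unique h1 h2. Qed.

Lemma has_der_near E (v w : R -> E) Y :
  (\forall t \near (0 : R), v t = w t) -> has_der v Y -> has_der w Y.
Proof.
move=> vw; apply: cvg_trans; apply: near_eq_cvg.
have v0 := nbhs_singleton vw.
have /nbhs_dnbhs vw' := vw.
by near=> t; rewrite /diff_quot -v0 (near vw' t).
Unshelve. all: by end_near. Qed.

Lemma diff_eps E F (f : E -> F) a : differentiable f a ->
  forall e, 0 < e ->
  \forall x \near a, `|f x - f a - 'd f a (x - a)| <= e * `|x - a|.
Proof.
move=> df e e0; rewrite (near_shift 0 a) subr0.
have /eqaddoP /(_ _ e0) := diff_locally df.
apply: filterS => h /=; rewrite addrK; congr (`|_| <= _).
by rewrite !fctE opprD addrA.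
Qed.

Lemma has_der_bound E (v : R -> E) Y : has_der v Y ->
  \forall t \near 0^', `|diff_quot v t| <= `|Y| + 1.
Proof. by move=> h; apply: cvgr_norm_le h _ _; rewrite ltrDl. Qed.

Lemma diff_quotK E (v : R -> E) t : t != 0 -> v t - v 0 = t *:_R diff_quot v t.
Proof. by move=> t0; rewrite rscaleVK. Qed.

(** The remainder in the definition of differentiability is at most
    [e * |v t - v 0|], and the difference quotients of [v] stay bounded. *)
Lemma has_der_diff E F (f : E -> F) (v : R -> E) Y :
  differentiable f (v 0) -> has_der v Y -> has_der (f \o v) ('d f (v 0) Y).
Proof.
move=> df hv; set D : E -> F := 'd f (v 0).
have cD : continuous D by exact: diff_continuous.
suff h : (diff_quot (f \o v) t - D (diff_quot v t)) @[t --> 0^'] --> (0 : F).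
  have h2 : D (diff_quot v t) @[t --> 0^'] --> D Y by apply: continuous_cvg => //; exact: cD.
  rewrite /has_der -[X in _ --> X]add0r; apply: cvg_trans (cvgD h h2).
  by apply: near_eq_cvg; near=> t; rewrite /= subrK.
apply/cvgr0Pnorm_le => e e0.
have b0 : 0 < `|Y| + 1 by rewrite ltr_wpDl.
have h := has_der_cvg hv (diff_eps df (divr_gt0 e0 b0)).
have hb := has_der_bound hv.
near=> t.
have t0 : t != 0 by near: t; exact: nbhs_dnbhs_neq.
have ht : `|f (v t) - f (v 0) - 'd f (v 0) (v t - v 0)| <=
  e / (`|Y| + 1) * `|v t - v 0| by near: t.
move: ht; rewrite diff_quotK // => ht.
have -> : diff_quot (f \o v) t - D (diff_quot v t) =
  t^-1 *:_R (f (v t) - f (v 0) - 'd f (v 0) (t *:_R diff_quot v t)).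
  rewrite linear_rscale -/D [RHS]rscalerB. congr (_ - _); exact/esym/rscaleKV.
rewrite norm_rscale.
apply: le_trans
  (_ : (`|t^-1|)%:C * (e / (`|Y| + 1) * `|t *:_R diff_quot v t|) <= _).
  by rewrite ler_wpM2l ?lecR // ht.
rewrite norm_rscale mulrCA [_%:C * (_ * _)]mulrA -rmorphM -normrM mulVf // normr1 mul1r.
rewrite -mulrA ler_piMr ?(ltW e0) // ler_pdivrMl // mulr1.
by near: t.
Unshelve. all: by end_near. Qed.

End Curves.

Section RowCurves.
Variables (R : realType) (n : nat).
Local Notation V := 'rV[Cplx R]_n.

Lemma rV_linear_continuous (E : normedModType (Cplx R)) (f : {linear V -> E}) :
  continuous f.
Proof.
have -> : (f : V -> E) = fun y => \sum_(j < n) y 0 j *: f (delta_mx 0 j).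
  apply/funext => y; rewrite [in LHS](row_sum_delta y) linear_sum /=.
  by apply: eq_bigr => j _; rewrite linearZ.
apply: (@continuous_big _ _ +%R) => [|j _ y].
  exact: add_continuous.
have FF : Filter (nbhs y) by exact: nbhs_filter.
by apply: (@cvgZ _ _ _ _ FF); [exact: coord_continuous|exact: cvg_cst].
Qed.

Lemma has_der_linear (E F : normedModType (Cplx R)) (f : {linear E -> F}) (v : R -> E) Y :
  continuous f -> has_der v Y -> has_der (f \o v) (f Y).
Proof.
move=> cf hv.
have df : differentiable f (v 0) by apply: linear_differentiable; exact: cf.
by have := has_der_diff df hv; rewrite diff_lin.
Qed.

(** A continuous lift of a differentiable curve is differentiable: after composing with
    the inverse of the differential, [v] differs from a differentiable curve by
    [o(|v t - v 0|)], which first bounds and then determines its difference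
    quotients. *)
Lemma has_der_inv (f : V -> V) (v : R -> V) W :
  differentiable f (v 0) -> injective ('d f (v 0)) ->
  v t @[t --> 0] --> v 0 -> has_der (f \o v) W ->
  exists2 Y, has_der v Y & 'd f (v 0) Y = W.
Proof.
move=> df injD cv hW; set D : {linear V -> V} := 'd f (v 0).
set A := lin1_mx D.
have uA : A \in unitmx.
  rewrite -row_free_unit -kermx_eq0; apply/rowV0P => u /sub_kermxP.
  by rewrite mul_rV_lin1 => uA; apply: injD; rewrite linear0.
pose I : {linear V -> V} := mulmxr (invmx A).
have ID w : I (D w) = w by rewrite /I /= -mul_rV_lin1 mulmxK.
have cI : continuous I by exact: rV_linear_continuous.
have [k k0 hk] := linear_lipschitz cI.
suff h : has_der v (I W).
  by exists (I W) => //; apply: has_der_unique (has_der_diff df h) hW.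
have hIW : has_der (fun t => I (f (v t))) (I W) by exact: (has_der_linear cI hW).
have b0 : 0 < `|I W| + 1 by rewrite ltr_wpDl.
have hb := has_der_bound hIW.
apply/cvgrPdist_le => e e0.
(* [m] is chosen so that [m <= 1/2] and [m * (2 * b) <= e / 2]. *)
set b := `|I W| + 1; rewrite -/b in b0 hb.
have c0 : 0 < 2 * b + e by rewrite addr_gt0 // mulr_gt0.
set m := e / 2 / (2 * b + e).
have m0 : 0 < m by rewrite !divr_gt0.
have m1 : m <= 2^-1.
  rewrite /m mulrAC ler_piMl ?invr_ge0 // ler_pdivrMr // mul1r lerDr.
  by apply: mulr_ge0 => //; exact: ltW.
have m2 : m * (2 * b) <= e / 2.
  rewrite /m mulrAC -mulrA ler_piMr ?divr_ge0 ?(ltW e0) // ler_pdivrMr //.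
  by rewrite mul1r lerDl; exact: ltW.
have hq : \forall t \near 0^', `|I W - diff_quot (fun t => I (f (v t))) t| <= e / 2.
  by move: (divr_gt0 e0 (ltr0Sn _ 1)); move: hIW => /cvgrPdist_le; apply.
have hd := nbhs_dnbhs (cv _ (diff_eps df (divr_gt0 m0 k0))).
near=> t.
have t0 : t != 0 by near: t; exact: nbhs_dnbhs_neq.
have ht : `|diff_quot (fun t => I (f (v t))) t - diff_quot v t| <= m * `|diff_quot v t|.
  have -> : diff_quot (fun t => I (f (v t))) t - diff_quot v t =
     I (t^-1 *:_R (f (v t) - f (v 0) - D (v t - v 0))).
    have eI : I (f (v t) - f (v 0) - D (v t - v 0)) = I (f (v t)) - I (f (v 0)) - (v t - v 0).
      by rewrite -[in RHS](ID (v t - v 0)) /I /= !mulmxBl.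
    by rewrite (linear_rscale I) eI [RHS]rscalerB.
  apply: le_trans (hk _) _; rewrite norm_rscale.
  have hx : `|f (v t) - f (v 0) - D (v t - v 0)| <= m / k * `|v t - v 0| by near: t.
  rewrite -ler_pdivlMl //.
  rewrite /diff_quot norm_rscale [m * _]mulrCA [k^-1 * _]mulrCA [k^-1 * (m * _)]mulrA [k^-1 * m]mulrC.
  by rewrite ler_wpM2l ?lecR.
have h1 : `|diff_quot v t| <= 2 * b.
  have h2 : `|diff_quot v t| <= b + 2^-1 * `|diff_quot v t|.
    rewrite -[X in `|X| <= _](subKr (diff_quot (fun t => I (f (v t))) t)).
    apply: le_trans (ler_normB _ _) _; apply: lerD; first by near: t.
    by apply: le_trans ht _; rewrite ler_wpM2r.
  rewrite -(ler_pM2l (_ : 0 < (2^-1 : Cplx R))) ?invr_gt0 // mulKf //.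
  rewrite -(lerD2r (2^-1 * `|diff_quot v t|)) -mulrDl.
  have -> : (2^-1 + 2^-1) * `|diff_quot v t| = `|diff_quot v t|.
    by rewrite -[in RHS](mul1r `|diff_quot v t|) [1 in RHS](splitr 1) mul1r.
  by [].
apply: le_trans (ler_distD (diff_quot (fun t => I (f (v t))) t) _ _) _.
rewrite [leRHS](splitr e); apply: lerD; first by near: t.
by apply: le_trans ht _; apply: le_trans m2; rewrite ler_wpM2l // ltW.
Unshelve. all: by end_near. Qed.

Lemma norm_conj_mx (v : V) : `|map_mx Num.conj v| = `|v|.
Proof.
rewrite /Num.norm /= !mx_normE; congr (_%:num).
by apply: eq_bigr => i _; apply/val_inj; rewrite /= mxE norm_conjC.
Qed.

Lemma conj_mx_rscale (t : R) (v : V) : map_mx Num.conj (t *:_R v) = t *:_R map_mx Num.conj v.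
Proof.
apply/rowP => j; rewrite !mxE rmorphM /=; congr (_ * _).
by apply/eqP; rewrite eq_complex /= eqxx oppr0 eqxx.
Qed.

Lemma cvg_conj_mx (T : Type) (G : set_system T) {FG : Filter G} (v : T -> V) Y :
  v x @[x --> G] --> Y -> map_mx Num.conj (v x) @[x --> G] --> map_mx Num.conj Y.
Proof.
move=> /cvgrPdist_lt h; apply/cvgrPdist_lt => e e0.
by apply: filterS (h e e0) => x; rewrite -map_mxB norm_conj_mx.
Qed.

Lemma has_der_conj (v : R -> V) Y :
  has_der v Y -> has_der (fun t => map_mx Num.conj (v t)) (map_mx Num.conj Y).
Proof.
move=> h; apply: cvg_trans (cvg_conj_mx h).
apply: near_eq_cvg; near=> t.
by rewrite /diff_quot conj_mx_rscale map_mxB.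
Unshelve. all: by end_near. Qed.

End RowCurves.

Section MoreCurves.
Variables (R : realType).
Implicit Types (E F : normedModType (Cplx R)).

Lemma has_der_cst E (x : E) : has_der (fun=> x) 0.
Proof.
rewrite /has_der; have -> : diff_quot (fun=> x : E) = fun=> 0.
  by apply/funext => t; rewrite /diff_quot subrr rscaler0.
exact: cvg_cst.
Qed.

Lemma has_der_line E (x Y : E) : has_der (fun t : R => x + t *:_R Y) Y.
Proof.
rewrite /has_der; apply: cvg_trans (_ : (fun=> Y) @ 0^' --> Y); last exact: cvg_cst.
apply: near_eq_cvg; near=> t.
rewrite /diff_quot rscale0 addr0 addrC addKr rscaleKV //.
by near: t; exact: nbhs_dnbhs_neq.
Unshelve. all: by end_near. Qed.

Lemma has_der_pair E F (v : R -> E) (w : R -> F) Y Z :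
  has_der v Y -> has_der w Z -> has_der (fun t => (v t, w t)) ((Y, Z) : (E * F)%type).
Proof.
by move=> h1 h2; exact: (cvg_pair h1 h2).
Qed.

(** A real-linear coordinate of [f] is a real function with zero derivative, to which
    the mean value theorem applies; [c] selects real or imaginary parts. *)
Lemma ReC_const n (f : R -> 'rV[Cplx R]_n) (r : R) (c : Cplx R) j :
  0 < r -> (forall t, `|t| < r -> has_der (fun h => f (t + h)) 0) ->
  forall t, `|t| < r -> ReC (c * f t 0 j) = ReC (c * f 0 0 j).
Proof.
move=> r0 hf; pose g t := ReC (c * f t 0 j).
have ReB (a b : Cplx R) : ReC (a - b) = ReC a - ReC b by case: a; case: b.
have hg t : `|t| < r -> is_derive (t : R) 1 g 0.
  move=> /hf ht.
  pose L (h : R) := ReC (c * (diff_quot (fun h => f (t + h)) h) 0 j).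
  have cont : continuous (fun y : 'rV[Cplx R]_n => ReC (c * y 0 j)).
    move=> y; have FF : Filter (nbhs y) by exact: nbhs_filter.
    apply: (cvg_comp (fun y : 'rV[Cplx R]_n => c * y 0 j) (@ReC R)); last exact: cvg_Re.
    by apply: cvgM; [exact: cvg_cst|exact: coord_continuous].
  have hL : L h @[h --> 0^'] --> (0 : R).
    rewrite [X in _ --> X](_ : (0 : R) = ReC (c * (0 : 'rV[Cplx R]_n) 0 j));
      last by rewrite mxE mulr0.
    exact: (cvg_comp (diff_quot (fun h => f (t + h)))
      (fun y : 'rV[Cplx R]_n => ReC (c * y 0 j)) ht (cont 0)).
  have hD : (h^-1 *: (g (h *: (1 : R) + t) - g t)) @[h --> 0^'] --> (0 : R).
    apply: cvg_trans hL; apply: near_eq_cvg; near=> h.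
    rewrite /L /diff_quot addr0 /g -ReB -mulrBr [h%:A]mulr1 addrC.
    rewrite !mxE mulrCA.
    rewrite [- _ + _]addrC [t + h]addrC. by case: (c * _) => a b; rewrite /ReC /= mul0r subr0.
  apply: DeriveDef; first by apply/cvg_ex; exists 0.
  exact: cvg_lim hD.
have gab a b : a <= b -> `|a| < r -> `|b| < r -> g b = g a.
  move=> ab ar br.
  have hin x : x \in `[a, b] -> `|x| < r.
    rewrite in_itv /= => /andP[ax xb]; move: ar br.
    rewrite !ltr_norml => /andP[a1 a2] /andP[b1 b2].
    by rewrite (lt_le_trans a1 ax) (le_lt_trans xb b2).
  have [x xab||z _] := @MVT_segment R g (fun=> 0) a b ab; last first.
  - by rewrite mul0r => /eqP; rewrite subr_eq0 => /eqP.
  - apply: derivable_within_continuous => x /hin xr.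
    by have [] := hg x xr.
  - by apply: hg; apply: hin; apply: subset_itv_oo_cc.
move=> t ht; have r00 : `|0 : R| < r by rewrite normr0.
by have [t0|/ltW t0] := leP 0 t; [exact: gab|apply/esym; exact: gab].
Unshelve. all: by end_near. Qed.

Lemma zero_der_const n (f : R -> 'rV[Cplx R]_n) (r : R) :
  0 < r -> (forall t, `|t| < r -> has_der (fun h => f (t + h)) 0) ->
  forall t, `|t| < r -> f t = f 0.
Proof.
move=> r0 hf t ht; apply/rowP => j.
have h1 := ReC_const 1 j r0 hf ht.
have h2 := ReC_const ('i) j r0 hf ht.
move: h1 h2; case: (f t 0 j) => a b; case: (f 0 0 j) => c d.
rewrite /ReC !mul1r /= !mul0r !mul1r !sub0r => -> /oppr_inj ->.
by [].
Qed.

End MoreCurves.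

Lemma eventually0_lim (K : numFieldType) (E : normedModType K) (u : nat -> E) l :
  u k @[k --> \oo] --> l -> (\forall k \near \oo, u k = 0) -> l = 0.
Proof.
move=> ul u0; have h : u k @[k --> \oo] --> (0 : E).
  apply: cvg_trans (_ : (fun=> 0) @ \oo --> (0 : E)); last exact: cvg_cst.
  by apply: near_eq_cvg; apply: filterS u0 => k ->.
exact: cvg_unique ul h.
Qed.

(** * Curves in a complex Lie group, read in charts *)

Section ChartCurves.
Variables (R : realType).
Implicit Types E F : normedModType (Cplx R).
Implicit Types M N : topologicalType.

Lemma near0_comp (T : topologicalType) (g : R -> T) (A : set T) :
  {for 0, continuous g} -> open A -> A (g 0) -> \forall t \near (0 : R), A (g t).
Proof. by move=> cg oA Ag; apply: cg; apply: open_nbhs_nbhs. Qed.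

(** The chain rule in charts: along a curve, differentiability of the transition map at
    the single point [cfwd a (g 0)] suffices. *)
Lemma holomorphic_curve E F M N (A : set (chart E M)) (B : set (chart F N))
    (f : M -> N) a b (g : R -> M) Y :
  holomorphic A B f -> A a -> B b ->
  open (cdom a) -> (forall x, cdom a x -> cbwd a (cfwd a x) = x) ->
  {for 0, continuous g} -> cdom a (g 0) -> cdom b (f (g 0)) ->
  has_der (cfwd a \o g) Y ->
  {for 0, continuous (f \o g)} /\
  has_der (cfwd b \o f \o g)
     ('d (cfwd b \o f \o cbwd a) (cfwd a (g 0)) Y).
Proof.
move=> [cf hf] Aa Bb oa ka cg ag bg hg; split.
  by apply: continuous_comp; [exact: cg|exact: cf].
have [df _] : _ /\ _ := hf a b Aa Bb (cfwd a (g 0)) (ex_intro2 _ _ (g 0) (conj ag bg) erefl).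
have := has_der_diff (v := cfwd a \o g) df hg.
apply: has_der_near; near=> t.
have : cdom a (g t) by near: t; exact: near0_comp.
by move=> /ka /= ->.
Unshelve. all: by end_near. Qed.

End ChartCurves.

Section LieGroup.
Variables (R : realType) (n : nat) (G : complexLieGroupType R n).
Local Notation V := 'rV[Cplx R]_n.
Local Notation atl := (@atlas R n G).
Local Notation c1 := (@chart1 R n G).
Local Notation "1" := (1%g : G) : group_scope.

Lemma atlas_chart c : atl c -> is_chart c.
Proof. by case: (@atlasP R n G) => h _ _; exact: h. Qed.

Lemma atlas_cover x : exists2 c, atl c & cdom c x.
Proof. by case: (@atlasP R n G). Qed.

Lemma atlas_open c : atl c -> open (cdom c).
Proof. by move=> /atlas_chart[]. Qed.

Lemma atlasK c : atl c -> forall x, cdom c x -> cbwd c (cfwd c x) = x.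
Proof. by move=> /atlas_chart[]. Qed.

(** All differential calculus on the group is done at the identity: a curve through
    [x] is studied by translating it back to [1]. *)
Definition velocity (g : R -> G) (X : V) : Prop :=
  [/\ g 0 = 1%g, {for 0, continuous g} & has_der (cfwd c1 \o g) X].

(** The differential of the multiplication at [(x, y)] in arbitrary charts. *)
Lemma mul_curve a b c (x y : G) : atl a -> atl b -> atl c ->
  cdom a x -> cdom b y -> cdom c (x * y)%g ->
  exists L : {linear (V * V)%type -> V}, forall (g h : R -> G) Y Z, g 0 = x -> h 0 = y ->
  {for 0, continuous g} -> {for 0, continuous h} ->
  has_der (cfwd a \o g) Y -> has_der (cfwd b \o h) Z ->
  {for 0, continuous (fun t => (g t * h t)%g)} /\
  has_der (fun t => cfwd c (g t * h t)%g) (L (Y, Z)).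
Proof.
move=> Aa Ab Ac ax bY cxy.
exists ('d (cfwd c \o (fun p : G * G => p.1 * p.2)%g \o cbwd (prod_chart a b))
          (cfwd a x, cfwd b y)).
move=> g h Y Z gx hy cg ch hg hh; subst x y.
apply: (@holomorphic_curve R _ _ _ _ _ _ _ (prod_chart a b) c
  (fun t => (g t, h t)) (Y, Z) (@lie_mul_holo R n G)) => //.
- by exists a, b.
- rewrite openE => -[u v] [/= au bv]; exists (cdom a, cdom b) => //=.
  by split; apply: open_nbhs_nbhs; split => //; exact: atlas_open.
- by move=> [u v] [/= au bv]; rewrite !atlasK.
- by apply: cvg_pair; [exact: cg|exact: ch].
- exact: (@has_der_pair R V V (cfwd a \o g) (cfwd b \o h) Y Z hg hh).
Qed.

Lemma left_curve a b (x y : G) : atl a -> atl b -> cdom a y -> cdom b (x * y)%g ->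
  exists2 L : V -> V, linear L & forall (g : R -> G) Y, g 0 = y ->
  {for 0, continuous g} -> has_der (cfwd a \o g) Y ->
  {for 0, continuous (fun t => (x * g t)%g)} /\
  has_der (fun t => cfwd b (x * g t)%g) (L Y).
Proof.
move=> Aa Ab ay bxy; have [c Ac cx] := atlas_cover x.
have [L hL] := mul_curve Ac Aa Ab cx ay bxy.
exists (fun Y => L (0, Y)) => [k u v|g Y g0 cg hg].
  by rewrite -linearP; congr (L (_, _)); rewrite /= scaler0 addr0.
have cx0 : {for (0 : R), continuous (fun=> x)} by exact: cvg_cst.
have hx0 := @has_der_cst R _ (cfwd c x).
have := hL (fun=> x) g 0 Y erefl g0 cx0 cg hx0 hg; exact.
Qed.

Lemma right_curve a b (x y : G) : atl a -> atl b -> cdom a x -> cdom b (x * y)%g ->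
  exists2 L : V -> V, linear L & forall (g : R -> G) Y, g 0 = x ->
  {for 0, continuous g} -> has_der (cfwd a \o g) Y ->
  {for 0, continuous (fun t => (g t * y)%g)} /\
  has_der (fun t => cfwd b (g t * y)%g) (L Y).
Proof.
move=> Aa Ab ax bxy; have [c Ac cy] := atlas_cover y.
have [L hL] := mul_curve Aa Ac Ab ax cy bxy.
exists (fun Y => L (Y, 0)) => [k u v|g Y g0 cg hg].
  by rewrite -linearP; congr (L (_, _)); rewrite /= scaler0 addr0.
have cy0 : {for (0 : R), continuous (fun=> y)} by exact: cvg_cst.
have hy0 := @has_der_cst R _ (cfwd c y).
exact: (hL g (fun=> y) Y 0 g0 erefl cg cy0 hg hy0).
Qed.

Lemma atlas_chart1 : atl c1. Proof. exact: chart1_atlas. Qed.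
Lemma chart1_at1 : cdom c1 1%g. Proof. exact: chart1_dom. Qed.
Hint Resolve atlas_chart1 chart1_at1 : core.

Lemma velocity_cst : velocity (fun=> 1%g) 0.
Proof. by split => //; [exact: cvg_cst|exact: has_der_cst]. Qed.

Lemma velocity_unique g X Y : velocity g X -> velocity g Y -> X = Y.
Proof. by move=> [_ _ h1] [_ _ h2]; exact: has_der_unique h1 h2. Qed.

Lemma velocity_line X : velocity (fun t => cbwd c1 (cfwd c1 1%g + t *:_R X)) X.
Proof.
have [_ oI kK _ cb] := atlas_chart atlas_chart1.
have k1 := kK _ chart1_at1.
have cl : {for 0, continuous (fun t : R => cfwd c1 (1%g : G) + t *:_R X)}.
  by apply: cvgD; [exact: cvg_cst|apply: cvg_rscale; [exact: cvg_id|exact: cvg_cst]].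
have i0 : (cfwd c1 @` cdom c1) (cfwd c1 (1%g : G)) by exists 1%g.
split; first by rewrite rscale0 addr0.
- apply: (@continuous_comp _ _ _ _ (cbwd c1)) => //; rewrite rscale0 addr0.
  by move: cb; rewrite continuous_open_subspace // => cb; apply: cb; rewrite inE.
- apply: (has_der_near _ (@has_der_line R V (cfwd c1 (1%g : G)) X)).
  have : \forall t \near (0 : R), (cfwd c1 @` cdom c1) (cfwd c1 (1%g : G) + t *:_R X).
    by apply: near0_comp => //; rewrite rscale0 addr0.
  by apply: filterS => t [x dx /= <-]; rewrite kK.
Qed.

(** The differential of the multiplication at [(1, 1)] is linear, and it is determined by
    its restrictions to both factors, where one of the curves is constant. *)
Lemma velocity_mul g h X Y :
  velocity g X -> velocity h Y -> velocity (fun t => g t * h t)%g (X + Y).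
Proof.
move=> cX cY.
have [L hL] : exists L : {linear (V * V)%type -> V}, forall g h X Y,
    velocity g X -> velocity h Y -> velocity (fun t => g t * h t)%g (L (X, Y)).
  have c11 : cdom c1 (1 * 1 : G)%g by rewrite mulg1.
  have [L hL] := mul_curve atlas_chart1 atlas_chart1 atlas_chart1 chart1_at1 chart1_at1 c11.
  exists L => g1 h1 X1 Y1 [g10 cg1 hg1] [h10 ch1 hh1].
  have [? ?] := hL _ _ _ _ g10 h10 cg1 ch1 hg1 hh1.
  by split => //; rewrite g10 h10 mulg1.
suff -> : X + Y = L (X, Y) by exact: hL.
have L1 : L (X, 0) = X.
  have := hL _ _ _ _ cX velocity_cst; under eq_fun do rewrite mulg1.
  by move=> h1; apply: velocity_unique h1 cX.
have L2 : L (0, Y) = Y.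
  have := hL _ _ _ _ velocity_cst cY; under eq_fun do rewrite mul1g.
  by move=> h1; apply: velocity_unique h1 cY.
by rewrite -{1}L1 -{1}L2 -linearD; congr (L (_, _)); rewrite /= ?addr0 ?add0r.
Qed.

(** A differential at the identity, as a map on velocities of curves; this covers the
    holomorphic and the antiholomorphic case alike. *)
Definition tangent_map (f : G -> G) (L : V -> V) : Prop :=
  forall g X, velocity g X -> velocity (f \o g) (L X).

Lemma tangent_mapE f L : tangent_map f L -> lie_map f = L.
Proof.
move=> h; apply/funext => X; have [_ _ hX] := h _ _ (velocity_line X).
exact: cvg_lim hX.
Qed.

Lemma tangent_map_lie f L : tangent_map f L -> tangent_map f (lie_map f).
Proof. by move=> h; rewrite (tangent_mapE h). Qed.

Lemma tangent_map_comp f1 f2 L1 L2 :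
  tangent_map f1 L1 -> tangent_map f2 L2 -> tangent_map (f1 \o f2) (L1 \o L2).
Proof. by move=> h1 h2 g X /h2 /h1. Qed.

Lemma conj_tangent u : exists2 L : V -> V, linear L & tangent_map (conj_by u) L.
Proof.
have [a Aa au] := atlas_cover u.
have au1 : cdom a (u * 1)%g by rewrite mulg1.
have [L1 lL1 h1] := left_curve atlas_chart1 Aa chart1_at1 au1.
have cuu : cdom c1 (u * u^-1)%g by rewrite mulgV.
have [L2 lL2 h2] := right_curve Aa atlas_chart1 au cuu.
exists (L2 \o L1) => [k v w|g X [g0 cg hg]]; first by rewrite /= lL1 lL2.
have [c' d'] := h1 _ _ g0 cg hg.
have g0' : (u * g 0)%g = u by rewrite g0 mulg1.
have [c'' d''] := h2 _ _ g0' c' d'.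
by split => //=; rewrite /conj_by g0 mulg1 mulgV.
Qed.

Lemma tangent_Ad u : tangent_map (conj_by u) (Ad u).
Proof. by have [L _ h] := conj_tangent u; exact: tangent_map_lie h. Qed.

Lemma Ad_linear (u : G) : linear (Ad u).
Proof. by have [L l h] := conj_tangent u; rewrite /Ad (tangent_mapE h). Qed.

Lemma holo_tangent f : holomorphic atl atl f -> f 1%g = 1%g ->
  exists2 L : V -> V, linear L & tangent_map f L.
Proof.
move=> hf f1; pose L := 'd (cfwd c1 \o f \o cbwd c1) (cfwd c1 1%g).
exists L => [k u v|g X [g0 cg hg]]; first by rewrite linearP.
have d0 : cdom c1 (g 0) by rewrite g0.
have d1 : cdom c1 (f (g 0)) by rewrite g0 f1.
have [c' h] := holomorphic_curve hf atlas_chart1 atlas_chart1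
  (atlas_open atlas_chart1) (atlasK atlas_chart1) cg d0 d1 hg.
by rewrite g0 in h; split; [rewrite /= g0|exact: c'|exact: h].
Qed.

(** In a conjugate chart the map is holomorphic, so its differential is a complex
    linear map followed by coordinatewise conjugation. *)
Lemma antiholo_tangent f : antiholomorphic atl atl f -> f 1%g = 1%g ->
  exists2 L : V -> V, antilinear L & tangent_map f L.
Proof.
move=> hf f1.
pose b := Chart (cdom c1) (fun x : G => map_mx Num.conj (cfwd c1 x))
   (fun z : V => cbwd c1 (map_mx Num.conj z)).
have Bb : conj_atlas atl b by exists c1.
pose D := 'd (cfwd b \o f \o cbwd c1) (cfwd c1 1%g).
exists (fun X => map_mx Num.conj (D X)) => [k u v|g X [g0 cg hg]].
  by rewrite linearP map_mxD map_mxZ.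
have d0 : cdom c1 (g 0) by rewrite g0.
have d1 : cdom b (f (g 0)) by rewrite g0 f1.
have [c' h] := holomorphic_curve hf atlas_chart1 Bb
  (atlas_open atlas_chart1) (atlasK atlas_chart1) cg d0 d1 hg.
rewrite g0 in h; split; [by rewrite /= g0|exact: c'|].
have -> : cfwd c1 \o (f \o g) =
    fun t => map_mx Num.conj ((cfwd b \o f \o g) t) by
  apply/funext => t /=; rewrite -map_mx_comp map_mx_id //= => z; rewrite /= conjCK.
exact: has_der_conj h.
Qed.

End LieGroup.

(** * The exponential map and its differential *)

(** Words in a group.  Isolating them keeps terms that contain exponentials out of
    the associativity rewriting. *)
Section GroupIdentities.
Variable G : groupType.
Implicit Types a b g h k s u v w x y z : G.

Lemma grp_shift x y a b :
  (x * y * (b^-1 * a^-1) = x * a^-1 * (a * (y * b^-1) * a^-1))%g.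
Proof. by rewrite -!mulgA mulKg. Qed.
Lemma grp_conjM u v x : ((u * v) * x * (u * v)^-1 = u * (v * x * v^-1) * u^-1)%g.
Proof. by rewrite invgM !mulgA. Qed.
Lemma grp_exchange x y a b : (a * y = y * a -> x * y * (a * b) = (x * a) * (y * b))%g.
Proof. by move=> h; rewrite -!mulgA (mulgA y) -h !mulgA. Qed.
Lemma grp_conj_morph u x y : (u * (x * y) * u^-1 = (u * x * u^-1) * (u * y * u^-1))%g.
Proof. by rewrite !mulgA mulgVK. Qed.
Lemma grp_square x y :
  (x^-1 * x^-1 * (y * y) = (x^-1 * (x^-1 * y) * x) * (x^-1 * y))%g.
Proof. by rewrite -!mulgA mulVKg. Qed.

Lemma grp_conj_swap x s : (x * s * x^-1 = s^-1 -> s * (s^-1 * x * s^-1^-1) = s^-1 * x)%g.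
Proof. by move=> h; rewrite invgK !mulgA mulgV mul1g -h mulgVK. Qed.

Lemma grp_polar a k z w :
  (a^-1 * a^-1 * (w * a * k^-1 * z * (z * k * a * w)) =
   (a^-1 * a^-1) * w * (a^-1 * a^-1)^-1 *
   ((a^-1 * k^-1) * (z * z) * (a^-1 * k^-1)^-1) * w)%g.
Proof. by rewrite !invgM !invgK -!mulgA mulVKg. Qed.
Lemma grp_sq_polar k a : ((k * a^-1)^-1 * (k * a) = a * a)%g.
Proof. by rewrite invgM invgK -!mulgA mulKg. Qed.
Lemma grp_inv_polar a k z w :
  ((z^-1 * (k * a^-1) * w^-1)^-1 * (z * (k * a) * w) =
   w * a * k^-1 * z * (z * k * a * w))%g.
Proof. by rewrite !invgM !invgK !mulgA. Qed.

Lemma grp_twist a h b k : (a * h * 1 * (b * k)^-1 = a * (h * 1 * k^-1) * b^-1)%g.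
Proof. by rewrite invgM !mulg1 !mulgA. Qed.
Lemma grp_twist_polar k a b k' u :
  (u = k * a * 1 * (k' * b)^-1 -> k^-1 * u * k' * b = 1 * a)%g.
Proof. by move=> ->; rewrite invgM mulg1 mul1g !mulgA mulVg mul1g -!mulgA mulKg mulVg mulg1. Qed.
Lemma grp_twist_unit k u k' : (k^-1 * u * k' = 1 -> u = k * 1 * k'^-1)%g.
Proof. by move=> h; rewrite -h -!mulgA mulgV mulg1 mulVKg. Qed.
Lemma grp_twist_inv g h : ((g * 1 * h^-1)^-1 = h * 1 * g^-1)%g.
Proof. by rewrite !mulg1 invgM invgK. Qed.

End GroupIdentities.

Section Adjoint.
Variables (R : realType) (n : nat) (G : complexLieGroupType R n).
Local Notation V := 'rV[Cplx R]_n.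

(** Encodes the adjoint representation through its two characteristic properties; as the
    proof is opaque, the limit that defines [Ad] never gets unfolded. *)
Lemma adjoint_sig :
  {A : G -> V -> V | forall u, linear (A u) /\ tangent_map (conj_by u) (A u)}.
Proof. by exists (fun u => Ad u) => u; split; [exact: Ad_linear|exact: tangent_Ad]. Qed.

Definition adj : G -> V -> V := sval adjoint_sig.

Lemma adj_linear u : linear (adj u).
Proof. by case: (svalP adjoint_sig u). Qed.

Lemma adj_tangent u : tangent_map (conj_by u) (adj u).
Proof. by case: (svalP adjoint_sig u). Qed.

Lemma AdE u : Ad u = adj u.
Proof. exact: tangent_mapE (adj_tangent u). Qed.

End Adjoint.

Section Exponential.
Variables (R : realType) (n : nat) (G : complexLieGroupType R n).
Local Notation V := 'rV[Cplx R]_n.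
Local Notation atl := (@atlas R n G).
Local Notation c1 := (@chart1 R n G).
Variable e : V -> G.
Hypothesis he : is_exponential e.

Lemma exp_zero : e 0 = 1%g.
Proof.
have [_ h _] := he; have := h 0 0 0; rewrite addr0 rscale0.
by move/(congr1 (fun x => (e 0)^-1 * x)%g); rewrite mulVg mulKg.
Qed.

Lemma exp_rscaleD (X : V) s t : e ((s + t) *:_R X) = (e (s *:_R X) * e (t *:_R X))%g.
Proof. by have [_ h _] := he. Qed.

Lemma exp_opp X : e (- X) = (e X)^-1%g.
Proof.
apply/esym/mulg1_eq; have := exp_rscaleD X 1 (-1).
by rewrite subrr rscale0 exp_zero rscaleN rscale1 => <-.
Qed.

Lemma exp_rscaleN t X : e (t *:_R (- X)) = (e (t *:_R X))^-1%g.
Proof. by rewrite -(exp_opp (t *:_R X)) rscalerN. Qed.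

Lemma exp2 X : e (2 *:_R X) = (e X * e X)%g.
Proof. by have := exp_rscaleD X 1 1; rewrite !rscale1. Qed.

Lemma exp_cont : continuous e.
Proof. by have [[]] := he. Qed.

Lemma velocity_exp X : velocity (fun t => e (t *:_R X)) X.
Proof.
have [_ _ hv] := he; split; [by rewrite rscale0 exp_zero| |exact: hv].
apply: (@continuous_comp _ _ _ (fun t : R => t *:_R X)); last exact: exp_cont.
by apply: cvg_rscale; [exact: cvg_id|exact: cvg_cst].
Qed.

Lemma exp_inj X Y : (forall t : R, e (t *:_R X) = e (t *:_R Y)) -> X = Y.
Proof.
move=> h; apply: velocity_unique (velocity_exp X) _.
have -> : (fun t => e (t *:_R X)) = (fun t => e (t *:_R Y)) by exact/funext.
exact: velocity_exp.
Qed.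

(** The quotient [k t = g t * exp(-tX)] has velocity 0 at 0.  As
    [k (t + h) = k t * exp(tX) (k h) exp(-tX)], its coordinates have derivative 0
    as long as [k] stays in the chart at 1; hence [k = 1] for small times, and then
    for all times by taking powers. *)
Lemma oneparam_unique (g : R -> G) X :
  (forall s t, g (s + t) = (g s * g t)%g) -> velocity g X ->
  forall t, g t = e (t *:_R X).
Proof.
move=> gD cg.
have [k kE] : exists k : R -> G, k = fun t => (g t * e (t *:_R (- X)))%g by eexists.
have ck : velocity k 0 by rewrite kE; have := velocity_mul cg (velocity_exp (- X)); rewrite subrr.
have [k0 kc _] := ck.
have kD t h : k (t + h) = (k t * conj_by (e (t *:_R X)) (k h))%g.
  have e1 : e ((t + h) *:_R (- X)) = ((e (h *:_R X))^-1 * (e (t *:_R X))^-1)%g.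
    by rewrite addrC exp_rscaleD (exp_rscaleN h) (exp_rscaleN t).
  rewrite kE gD e1 (exp_rscaleN h) (exp_rscaleN t); exact: grp_shift.
have c1o : open (cdom c1) by exact: atlas_open (atlas_chart1 G).
have kn : \forall t \near (0 : R), cdom c1 (k t).
  by apply: near0_comp => //; rewrite k0; exact: chart1_at1.
have [r /= r0 hr] := kn.
have hr' t : `|t| < r -> cdom c1 (k t) by move=> tr; apply: hr; rewrite /= sub0r normrN.
have dk t : `|t| < r -> has_der (fun h => (cfwd c1 \o k) (t + h)) 0.
  move=> /hr' dt.
  have := adj_tangent (e (t *:_R X)) ck; rewrite (lin0 (adj_linear _)).
  set w := _ \o k => -[w0 wc hw].
  have dt1 : cdom c1 (k t * 1)%g by rewrite mulg1.
  have [L lL /(_ w 0 w0 wc hw) [_]] := left_curve (atlas_chart1 G) (atlas_chart1 G) (chart1_at1 G) dt1.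
  rewrite (lin0 lL).
  have -> : (fun h => (cfwd c1 \o k) (t + h)) = (fun h => cfwd c1 (k t * w h)%g).
    by apply/funext => h; rewrite /= kD.
  by [].
have small t : `|t| < r -> g t = e (t *:_R X).
  move=> tr; have E : cfwd c1 (k t) = cfwd c1 (k 0) := zero_der_const r0 dk tr.
  have kt : k t = 1%g.
    by rewrite -(atlasK (atlas_chart1 G) (hr' _ tr)) E (atlasK (atlas_chart1 G)) k0 //; exact: chart1_at1.
  by apply: divg1_eq; rewrite -(exp_rscaleN t X) -kt kE.
have mult s (j : nat) : g s = e (s *:_R X) -> g (j%:R * s) = e ((j%:R * s) *:_R X).
  move=> gs; elim: j => [|j IH]; first by rewrite mul0r rscale0 exp_zero; case: cg.
  by rewrite -natr1 mulrDl mul1r gD exp_rscaleD IH gs.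
move=> t.
have hj := truncnS_gt (`|t| / r); set j := (Num.trunc _).+1 in hj.
have j0 : (0 : R) < j%:R by rewrite ltr0n.
have -> : t = j%:R * (t / j%:R) by rewrite mulrC divfK // gt_eqF.
apply: mult; apply: small.
by rewrite normrM normfV (ger0_norm (ltW j0)) ltr_pdivrMr // mulrC -ltr_pdivrMr.
Qed.

Lemma morphism_expR f L : group_morphism f -> tangent_map f L ->
  forall (t : R) X, f (e (t *:_R X)) = e (t *:_R L X).
Proof.
move=> fM tf t X.
apply: (@oneparam_unique (fun t => f (e (t *:_R X)))) => [s u|].
  by rewrite exp_rscaleD fM.
exact: tf (velocity_exp X).
Qed.

Lemma morphism_exp f L : group_morphism f -> tangent_map f L ->
  forall X, f (e X) = e (L X).
Proof. by move=> fM tf X; have := morphism_expR fM tf 1 X; rewrite !rscale1. Qed.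

(** By uniqueness of one-parameter groups, [f (exp(tX)) = exp(t L X)]. *)
Lemma Lie_fixed f L : group_morphism f -> tangent_map f L ->
  forall X, Lie e (fixed f) X <-> L X = X.
Proof.
move=> fM tf X; split=> [h|h t]; last by rewrite /fixed /= (morphism_expR fM tf) h.
by apply: exp_inj => t; rewrite -(morphism_expR fM tf t X); exact: h.
Qed.

Lemma conj_morphism (u : G) : group_morphism (conj_by u).
Proof. by move=> x y; exact: grp_conj_morph. Qed.

Lemma conj_exp u X : (u * e X * u^-1)%g = e (adj u X).
Proof. exact: (morphism_exp (conj_morphism u) (adj_tangent u)). Qed.

Lemma exp_adj u X : (u * e X)%g = (e (adj u X) * u)%g.
Proof. by rewrite -conj_exp mulgVK. Qed.

Lemma adjR (u : G) (t : R) X : adj u (t *:_R X) = t *:_R adj u X.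
Proof. exact: linR (adj_linear u) t X. Qed.

Lemma conj_expR u t X : (u * e (t *:_R X) * u^-1)%g = e (t *:_R adj u X).
Proof. by rewrite conj_exp adjR. Qed.

Lemma adj_mulg (u v : G) X : adj (u * v)%g X = adj u (adj v X).
Proof.
apply: exp_inj => t.
have h1 := conj_expR (u * v)%g t X; have h2 := conj_expR u t (adj v X).
rewrite -h1 -h2 -(conj_expR v t X); exact: grp_conjM.
Qed.

Lemma adj_one (X : V) : adj (1%g : G) X = X.
Proof. by apply: exp_inj => t; rewrite -(conj_expR 1%g t X) invg1 mulg1 mul1g. Qed.

(** Turns infinitesimal invariance into commutation in the group, which is
    symmetric in its two arguments; this is how [commutes_sym] replaces the
    antisymmetry of the bracket. *)
Lemma adj_fixP (u : G) X : adj u X = X <->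
  forall t : R, (u * e (t *:_R X))%g = (e (t *:_R X) * u)%g.
Proof.
split=> [h t|h]; first by rewrite exp_adj adjR h.
by apply: exp_inj => t; rewrite -(conj_expR u t X) h mulgK.
Qed.

(** The relation [[X, Y] = 0], stated without brackets. *)
Definition commutes X Y : Prop := forall t : R, adj (e (t *:_R X)) Y = Y.

Lemma commutes_sym X Y : commutes X Y -> commutes Y X.
Proof.
move=> h s; apply/adj_fixP => t.
by have /adj_fixP -> := h t.
Qed.

(** With [commutes_sym] this gives commutation for arbitrary complex multiples: [Ad] of
    an element is complex linear, so commuting with [exp(tX)] for real [t]
    already implies commuting with [exp(i X)]. *)
Lemma commutesZ k X Y : commutes X Y -> commutes X (k *: Y).
Proof. by move=> h t; rewrite (linZ (adj_linear _)) h. Qed.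

Lemma commutes_self X : commutes X X.
Proof. by move=> t; apply/adj_fixP => s; rewrite -!exp_rscaleD addrC. Qed.

Lemma commutes1 X Y : commutes X Y -> adj (e X) Y = Y.
Proof. by move=> /(_ 1); rewrite rscale1. Qed.

Lemma commutes_expD X Y : commutes X Y -> e (X + Y) = (e X * e Y)%g.
Proof.
move=> h; pose g (t : R) := (e (t *:_R X) * e (t *:_R Y))%g.
have gD s t : g (s + t) = (g s * g t)%g.
  by rewrite /g !exp_rscaleD; apply: grp_exchange; have /adj_fixP hc := h t; rewrite (hc s).
have := oneparam_unique gD (velocity_mul (velocity_exp X) (velocity_exp Y)) 1.
by rewrite /g !rscale1 => <-.
Qed.

Lemma chart_exp_curve a X : atl a -> cdom a (e X) ->
  forall (v : R -> V) Y, v 0 = X -> {for 0, continuous v} -> has_der v Y ->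
  {for 0, continuous (e \o v)} /\ has_der (cfwd a \o e \o v) ('d (cfwd a \o e) X Y).
Proof.
move=> Aa ax v Y v0 cv hv; have [eh _ _] := he.
have ov : open (cdom (Chart setT id id : chart V V)) by exact: openT.
have av : cdom a (e (v 0)) by rewrite v0.
have [c' h] := @holomorphic_curve R V V V G (@vect_atlas R V) atl e
  (Chart setT id id) a v Y eh erefl Aa ov (fun _ _ => erefl) cv I av hv.
by rewrite -v0; split.
Qed.

Lemma exp_diff a X : atl a -> cdom a (e X) -> differentiable (cfwd a \o e) X.
Proof.
move=> Aa ax; have [[_ eh] _ _] := he.
have [] // := eh (Chart setT id id) a erefl Aa X.
by exists X.
Qed.

Lemma cvg_line (X Y : V) : {for 0, continuous (fun t : R => X + t *:_R Y)}.
Proof.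
by apply: cvgD; [exact: cvg_cst|apply: cvg_rscale; [exact: cvg_id|exact: cvg_cst]].
Qed.

(** The left logarithmic differential [J X] of the exponential map, that is,
    [exp(-X) d exp_X], characterized by its effect on curves. *)
Lemma dexp_sig X : {J : V -> V | linear J /\
  (forall (v : R -> V) Y, v 0 = X -> {for 0, continuous v} -> has_der v Y ->
   velocity (fun t => (e (- X) * e (v t))%g) (J Y))}.
Proof.
apply: cid.
have [a Aa ax] := atlas_cover (e X).
have c11 : cdom c1 (e (- X) * e X)%g by rewrite exp_opp mulVg; exact: chart1_at1.
have [L lL hL] := left_curve Aa (atlas_chart1 G) ax c11.
exists (fun Y => L ('d (cfwd a \o e) X Y)); split=> [k u w|v Y v0 cv hv].
  by rewrite linearP lL.
have [c' d'] := chart_exp_curve Aa ax v0 cv hv.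
have v0' : (e \o v) 0 = e X by rewrite /= v0.
have [c'' d''] := hL _ _ v0' c' d'.
by split => //; rewrite v0 exp_opp mulVg.
Qed.

Definition dexp (X : V) : V -> V := sval (dexp_sig X).

Lemma dexp_linear X : linear (dexp X).
Proof. by case: (svalP (dexp_sig X)). Qed.

Lemma velocity_dexp X (v : R -> V) Y : v 0 = X -> {for 0, continuous v} -> has_der v Y ->
   velocity (fun t => (e (- X) * e (v t))%g) (dexp X Y).
Proof. by case: (svalP (dexp_sig X)) => _; apply. Qed.

Lemma velocity_dexp_line X Y : velocity (fun t => (e (- X) * e (X + t *:_R Y))%g) (dexp X Y).
Proof.
apply: velocity_dexp; [by rewrite rscale0 addr0|exact: cvg_line|exact: has_der_line].
Qed.

(** Conjugation by [u] fixes [exp(X)] and transforms [exp(X + tY)] into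
    [exp(X + t Ad(u) Y)]. *)
Lemma dexp_adj (u : G) X Y : adj u X = X -> dexp X (adj u Y) = adj u (dexp X Y).
Proof.
move=> uX; apply: velocity_unique (velocity_dexp_line X (adj u Y)) _.
have -> : (fun t : R => (e (- X) * e (X + t *:_R adj u Y))%g) =
  conj_by u \o (fun t => (e (- X) * e (X + t *:_R Y))%g).
  apply/funext => t; rewrite /= conj_morphism.
  have h1 := conj_exp u (- X); have h2 := conj_exp u (X + t *:_R Y).
  rewrite (linN (adj_linear u)) uX in h1.
  rewrite (linD (adj_linear u)) uX adjR in h2.
  by rewrite /conj_by h1 h2.
exact: adj_tangent (velocity_dexp_line X Y).
Qed.

Lemma dexp_commutes X Y : commutes X Y -> dexp X Y = Y.
Proof.
move=> h; apply: velocity_unique (velocity_dexp_line X Y) _.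
have -> : (fun t : R => (e (- X) * e (X + t *:_R Y))%g) = (fun t => e (t *:_R Y)).
  apply/funext => t; rewrite commutes_expD; last exact: commutesZ.
  by rewrite exp_opp mulKg.
exact: velocity_exp.
Qed.

(** [exp(-2X) exp(2(X + tY))] is the square of [exp(-X) exp(X + tY)] up to a conjugation
    of one factor. *)
Lemma dexp_double X Y :
  dexp (2 *:_R X) (2 *:_R Y) = adj (e (- X)) (dexp X Y) + dexp X Y.
Proof.
apply: velocity_unique (velocity_dexp_line (2 *:_R X) (2 *:_R Y)) _.
have c1' := velocity_dexp_line X Y; have c2' := adj_tangent (e (- X)) c1'.
have := velocity_mul c2' c1'.
set g1 := (X in velocity X); set g2 := (X in _ -> velocity X _).
suff -> : g2 = g1 by [].
apply/funext => t; rewrite /g1 /g2 /= /conj_by.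
have -> : e (2 *:_R X + t *:_R (2 *:_R Y)) = (e (X + t *:_R Y) * e (X + t *:_R Y))%g.
  by rewrite -exp2 rscalerD !rscaleA mulrC.
by rewrite !exp_opp exp2 invgM invgK; exact: grp_square.
Qed.

End Exponential.

Section DexpAtZero.
Variables (R : realType) (n : nat) (G : complexLieGroupType R n).
Local Notation V := 'rV[Cplx R]_n.
Local Notation atl := (@atlas R n G).
Local Notation c1 := (@chart1 R n G).
Variable e : V -> G.
Hypothesis he : is_exponential e.
Local Notation J := (dexp he).

Lemma dexp_eq0_diff X Y : cdom c1 (e X) -> J X Y = 0 -> 'd (cfwd c1 \o e) X Y = 0.
Proof.
move=> dX JX; have := velocity_dexp_line he X Y; rewrite JX => -[w0 wc hw].
have dX1 : cdom c1 (e X * 1)%g by rewrite mulg1.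
have [L lL hL] := left_curve (atlas_chart1 G) (atlas_chart1 G) (chart1_at1 G) dX1.
have [_ h1] := hL _ _ w0 wc hw.
have lc : {for 0, continuous (fun t : R => X + t *:_R Y)} by exact: cvg_line.
have l0 : X + 0 *:_R Y = X by rewrite rscale0 addr0.
have [_ h2] := chart_exp_curve he (atlas_chart1 G) dX l0 lc (@has_der_line R V X Y).
rewrite (lin0 lL) in h1; apply: has_der_unique h2 _.
have -> : (cfwd c1 \o e) \o (fun t : R => X + t *:_R Y) =
   fun t : R => cfwd c1 (e X * (e (- X) * e (X + t *:_R Y)))%g.
  by apply/funext => t; rewrite /= exp_opp // mulVKg.
exact: h1.
Qed.

(** The differential of [exp] in the chart at 1 is continuous at 0, where it is the
    identity. *)
Lemma dexp_dyadic_inj X Y : (forall k, J ((2^-1) ^+ k *:_R X) Y = 0) -> Y = 0.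
Proof.
move=> hk.
have d0 : cdom c1 (e 0) by rewrite exp_zero //; exact: chart1_at1.
have lc : {for 0, continuous (fun t : R => 0 + t *:_R Y)} by exact: cvg_line.
have l0 : 0 + 0 *:_R Y = 0 :> V by rewrite rscale0 addr0.
have [_ h] := chart_exp_curve he (atlas_chart1 G) d0 l0 lc (@has_der_line R V 0 Y).
have [_ _ h'] := velocity_exp he Y.
have e0 : (fun t : R => 0 + t *:_R Y) = (fun t => t *:_R Y) by apply/funext => t; rewrite add0r.
rewrite e0 in h; rewrite -(has_der_unique h h').
have [[ec eh] _ _] := he.
have t0 : transition_dom (Chart setT id id) c1 e 0 by exists 0.
have [_ /(_ Y) hc] := eh (Chart setT id id) c1 erefl (atlas_chart1 G) 0 t0.
pose x (k : nat) : V := (2^-1) ^+ k *:_R X.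
have cx : x k @[k --> \oo] --> (0 : V).
  rewrite -(rscale0 X); apply: cvg_rscale; last exact: cvg_cst.
  by apply: cvg_expr; rewrite ger0_norm ?invr_ge0 // invf_lt1 // ltr1n.
have h1 : 'd (cfwd c1 \o e) (x k) Y @[k --> \oo] --> 'd (cfwd c1 \o e) 0 Y.
  exact: (cvg_comp x (fun y => 'd (cfwd c1 \o e) y Y) cx hc).
have hn : \forall k \near \oo, cdom c1 (e (x k)).
  have oc : nbhs (e 0) (cdom c1) by apply: open_nbhs_nbhs; split => //; exact: atlas_open (atlas_chart1 G).
  exact: (cx _ (ec 0 _ oc)).
apply: (eventually0_lim h1); apply: filterS hn => k dk.
exact: (dexp_eq0_diff dk (hk k)).
Qed.

End DexpAtZero.

Section Morphisms.
Variables (R : realType) (n : nat) (G : complexLieGroupType R n).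
Local Notation V := 'rV[Cplx R]_n.
Variable e : V -> G.
Hypothesis he : is_exponential e.

Lemma morphism1 (f : G -> G) : group_morphism f -> f 1%g = 1%g.
Proof. by move=> fM; apply: (mulgI (f 1%g)); rewrite -fM !mulg1. Qed.

Lemma morphismV (f : G -> G) x : group_morphism f -> f x^-1%g = (f x)^-1%g.
Proof. by move=> fM; apply/esym/mulg1_eq; rewrite -fM mulgV morphism1. Qed.

Lemma tangent_commute (f g : G -> G) L M : tangent_map f L -> tangent_map g M ->
  f \o g = g \o f -> forall X, L (M X) = M (L X).
Proof.
move=> tf tg fg X.
have h1 := tangent_mapE (tangent_map_comp tf tg); have h2 := tangent_mapE (tangent_map_comp tg tf).
by rewrite -[LHS]/((L \o M) X) -h1 fg h2.
Qed.

(** A one-parameter group that stays in a subgroup for small times stays there: take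
    powers. *)
Lemma Lie_near (H : set G) X : subgroup H ->
  (\forall t \near (0 : R), H (e (t *:_R X))) -> Lie e H X.
Proof.
move=> [H1 HM _] [r /= r0 hr] t.
have mult s (j : nat) : H (e (s *:_R X)) -> H (e ((j%:R * s) *:_R X)).
  move=> Hs; elim: j => [|j IH]; first by rewrite mul0r rscale0 (exp_zero he).
  by rewrite -natr1 mulrDl mul1r (exp_rscaleD he); exact: HM.
have hj := truncnS_gt (`|t| / r); set j := (Num.trunc _).+1 in hj.
have j0 : (0 : R) < j%:R by rewrite ltr0n.
have -> : t = j%:R * (t / j%:R) by rewrite mulrC divfK // gt_eqF.
apply: mult; apply: hr.
by rewrite /= sub0r normrN normrM normfV (ger0_norm (ltW j0)) ltr_pdivrMr // mulrC -ltr_pdivrMr.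
Qed.

End Morphisms.

(** * The Cartan decomposition *)

Section CompactForm.
Variables (R : realType) (n : nat) (G : complexLieGroupType R n).
Local Notation V := 'rV[Cplx R]_n.
Variables (e : V -> G) (U : set G) (delta : G -> G) (D : V -> V).
Hypotheses (he : is_exponential e) (hU : subgroup U)
  (hc : cartan_decomposition e U) (dM : group_morphism delta)
  (dI : involutive delta) (dfix : fixed delta = U) (dT : tangent_map delta D)
  (aD : antilinear D).
Local Notation J := (dexp he).
Local Notation "'uu'" := (Lie e U).

Lemma Lie_compactP X : uu X <-> D X = X.
Proof. by rewrite -dfix; exact: (Lie_fixed he dM dT). Qed.

Lemma DK X : D (D X) = X.
Proof.
apply: (exp_inj he) => t.
have h1 := morphism_expR he dM dT t X; have h2 := morphism_expR he dM dT t (D X).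
by rewrite -h2 -h1 dI.
Qed.

Lemma delta_exp X : delta (e X) = e (D X).
Proof. exact: (morphism_exp he dM dT). Qed.

Lemma delta_U u : U u <-> delta u = u.
Proof. by rewrite -dfix. Qed.

Lemma adj_delta u X : D (adj u X) = adj (delta u) (D X).
Proof.
apply: (exp_inj he) => t.
have h1 := morphism_expR he dM dT t (adj u X).
have h2 := morphism_expR he dM dT t X.
have h3 := conj_expR he u t X.
have h4 := conj_expR he (delta u) t (D X).
rewrite -h1 -h3 -h4 -h2 !dM; congr (_ * _)%g.
apply: (mulgI (delta u)); rewrite mulgV -dM mulgV.
by apply: (mulgI (delta 1%g)); rewrite -dM !mulg1.
Qed.

Lemma adj_U u X : U u -> D (adj u X) = adj u (D X).
Proof. by move=> /delta_U du; rewrite adj_delta du. Qed.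

Lemma uu_adj u X : U u -> uu X -> uu (adj u X).
Proof. by move=> Uu /Lie_compactP XX; apply/Lie_compactP; rewrite adj_U // XX. Qed.

Lemma cartan_unique u u' X X' : U u -> U u' -> uu X -> uu X' ->
  (u * e ('i *: X) = u' * e ('i *: X'))%g -> u = u' /\ X = X'.
Proof.
have [k [p [_ _ _ h]]] := hc => Uu Uu' uX uX' E.
have [a b] := h u X Uu uX; have [a' b'] := h u' X' Uu' uX'.
by split; [exact: etrans (esym a) (etrans (congr1 k E) a')|exact: etrans (esym b) (etrans (congr1 p E) b')].
Qed.

Lemma D_i X : uu X -> D ('i *: X) = - ('i *: X).
Proof. by move=> /Lie_compactP XX; rewrite (antilin_i aD) XX. Qed.

Lemma double_eq0 (Z : V) : Z + Z = 0 -> Z = 0.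
Proof.
move/eqP; rewrite -mulr2n -scaler_nat scaler_eq0 pnatr_eq0 /=.
by move/eqP.
Qed.

(** For [s = exp(tZ)] in [U] and [x = exp(iX)], the relation [x s x^-1 = s^-1] reads
    [s exp(i Ad(s^-1) X) = s^-1 exp(iX)], so [s = s^-1] by uniqueness in the Cartan
    decomposition. *)
Lemma no_inversion_u X Z : uu X -> uu Z -> adj (e ('i *: X)) Z = - Z -> Z = 0.
Proof.
move=> uX uZ h.
suff E : Z = - Z by apply: double_eq0; rewrite {1}E addNr.
apply: (exp_inj he) => t; rewrite (exp_rscaleN he).
have Us : U (e (t *:_R Z)) by exact: uZ.
have Us' : U (e (t *:_R Z))^-1%g by case: hU => _ _; apply.
have hh := conj_expR he (e ('i *: X)) t Z.
rewrite h (exp_rscaleN he) in hh.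
have := grp_conj_swap hh.
have -> := conj_exp he (e (t *:_R Z))^-1%g ('i *: X).
rewrite (linZ (adj_linear _)) => E.
by have [] := cartan_unique Us Us' (uu_adj Us' uX) uX E.
Qed.

(** Applying [delta], which inverts [exp(iX)], shows that the eigenspace is stable
    under [D]; hence it is spanned by its intersection with [u].  This is the only
    trace of the positivity of [Ad(exp(iX))] that the proof needs. *)
Lemma no_inversion X Z : uu X -> adj (e ('i *: X)) Z = - Z -> Z = 0.
Proof.
move=> uX h; set x := e _ in h.
have hD : adj x (D Z) = - D Z.
  have := congr1 D h; rewrite adj_delta /x delta_exp D_i // (exp_opp he) -/x (antilinN aD) => h'.
  have := congr1 (adj x) h'; rewrite -(adj_mulg he) mulgV (adj_one he) (linN (adj_linear x)).
  by move=> {2}->; rewrite opprK.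
have h1 : Z + D Z = 0.
  apply: (no_inversion_u uX); first by apply/Lie_compactP; rewrite (antilinD aD) DK addrC.
  by rewrite (linD (adj_linear _)) -/x h hD opprD.
have h2 : 'i *: (Z - D Z) = 0.
  apply: (no_inversion_u uX).
    by apply/Lie_compactP; rewrite (antilin_i aD) (antilinB aD) DK -scalerN opprB.
  by rewrite (linZ (adj_linear _)) (linB (adj_linear _)) -/x h hD -scalerN opprD.
have i0 : ('i : Cplx R) != 0 by rewrite eq_complex /= oner_eq0 andbF.
move/eqP: h2; rewrite scaler_eq0 (negbTE i0) /= subr_eq0 => /eqP h2.
by apply: double_eq0; rewrite {2}h2.
Qed.

Lemma uuR t X : uu X -> uu (t *:_R X).
Proof. by move=> uX s; rewrite rscaleA; exact: uX. Qed.

Lemma uuN X : uu X -> uu (- X).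
Proof. by move=> /Lie_compactP h; apply/Lie_compactP; rewrite (antilinN aD) h. Qed.

Lemma uuD X Y : uu X -> uu Y -> uu (X + Y).
Proof. by move=> /Lie_compactP h1 /Lie_compactP h2; apply/Lie_compactP; rewrite (antilinD aD) h1 h2. Qed.

Lemma dexp_half X Y : uu X -> J ('i *: X) Y = 0 -> J (2^-1 *:_R ('i *: X)) Y = 0.
Proof.
move=> uX h; set X' := 2^-1 *:_R ('i *: X).
have e2 : 'i *: X = 2 *:_R X' by rewrite /X' rscaleA mulfV ?rscale1 ?pnatr_eq0.
have eX' : X' = 'i *: (2^-1 *:_R X) by rewrite /X' rscaleC.
have h2 : J (2 *:_R X') (2 *:_R Y) = 0 by rewrite (linR (dexp_linear he _)) -e2 h rscaler0.
rewrite (dexp_double he) in h2.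
have uX' : uu (- (2^-1 *:_R X)) by apply: uuN; exact: uuR.
apply: (no_inversion uX'); rewrite scalerN -eX'.
by apply/eqP; rewrite -addr_eq0 h2.
Qed.

(** By [dexp_double] and [no_inversion] a zero of [J X] is a zero of [J (X / 2)], and so
    on down to 0. *)
Lemma dexp_inj X Y : uu X -> J ('i *: X) Y = 0 -> Y = 0.
Proof.
move=> uX h; apply: (@dexp_dyadic_inj _ _ _ _ he ('i *: X)) => k.
suff : J ('i *: ((2^-1) ^+ k *:_R X)) Y = 0 by rewrite -rscaleC.
elim: k => [|k IH]; first by rewrite expr0 rscale1.
by have := dexp_half (uuR _ uX) IH; rewrite rscaleC rscaleA -exprS.
Qed.

End CompactForm.

(** * The complex bilinear extension of the inner product *)

(** [D] is the conjugation of the complex space with respect to the real form [W]. *)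
Section ComplexForm.
Variables (R : realType) (n : nat).
Local Notation V := 'rV[Cplx R]_n.
Variables (W : set V) (D : V -> V) (ip : V -> V -> R).
Hypotheses (DK : involutive D)
  (aD : antilinear D)
  (WD : forall X, W X <-> D X = X) (hip : inner_product_on W ip).

(** The components of [X = re_part X + i im_part X] along the real form; the opaque
    proofs make their defining formulas available only through [re_partE] and
    [im_partE]. *)
Lemma re_part_sig : {r : V -> V | forall X, r X = 2^-1 *:_R (X + D X)}.
Proof. by exists (fun X => 2^-1 *:_R (X + D X)). Qed.
Lemma im_part_sig : {r : V -> V | forall X, r X = - ('i *: (2^-1 *:_R (X - D X)))}.
Proof. by exists (fun X => - ('i *: (2^-1 *:_R (X - D X)))). Qed.
Definition re_part : V -> V := sval re_part_sig.
Definition im_part : V -> V := sval im_part_sig.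
Lemma re_partE X : re_part X = 2^-1 *:_R (X + D X). Proof. exact: (svalP re_part_sig). Qed.
Lemma im_partE X : im_part X = - ('i *: (2^-1 *:_R (X - D X))). Proof. exact: (svalP im_part_sig). Qed.

Lemma W_add X Y : W X -> W Y -> W (X + Y).
Proof. by move=> /WD h1 /WD h2; apply/WD; rewrite (antilinD aD) h1 h2. Qed.
Lemma W_zero : W 0.
Proof. by apply/WD; exact: (antilin0 aD). Qed.
Lemma W_opp X : W X -> W (- X).
Proof. by move=> /WD h; apply/WD; rewrite (antilinN aD) h. Qed.
Lemma W_re_part X : W (re_part X).
Proof. by apply/WD; rewrite re_partE (antilinR aD) (antilinD aD) DK addrC. Qed.
Lemma W_im_part X : W (im_part X).
Proof.
apply/WD; rewrite im_partE (antilinN aD) (antilin_i aD) (antilinR aD) (antilinB aD) DK opprK.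
by rewrite -scalerN -rscalerN opprB.
Qed.

Lemma i_sq (X : V) : 'i *: ('i *: X) = - X.
Proof.
rewrite scalerA -[RHS]scaleN1r; congr (_ *: _).
by apply/eqP; rewrite eq_complex /=; apply/andP; split; apply/eqP; ring.
Qed.

Lemma rscale_half (X : V) : 2^-1 *:_R X + 2^-1 *:_R X = X.
Proof.
rewrite -rscaleD -[RHS]rscale1; congr (_ *:_R _); lra.
Qed.

Lemma re_im_part X : X = re_part X + 'i *: im_part X.
Proof.
rewrite im_partE scalerN i_sq opprK re_partE rscalerD rscalerB addrACA subrr addr0; exact/esym/rscale_half.
Qed.

Lemma re_part_id X : W X -> re_part X = X.
Proof. by move=> /WD h; rewrite !re_partE h rscalerD rscale_half. Qed.
Lemma im_part_id X : W X -> im_part X = 0.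
Proof. by move=> /WD h; rewrite !im_partE h subrr rscaler0 scaler0 oppr0. Qed.
Lemma re_partD X Y : re_part (X + Y) = re_part X + re_part Y.
Proof. by rewrite !re_partE (antilinD aD) -rscalerD addrACA. Qed.
Lemma im_partD X Y : im_part (X + Y) = im_part X + im_part Y.
Proof. by rewrite !im_partE (antilinD aD) -opprD -scalerDr -rscalerD opprD addrACA. Qed.
Lemma re_partR t X : re_part (t *:_R X) = t *:_R re_part X.
Proof. by rewrite !re_partE (antilinR aD) -rscalerD !rscaleA mulrC. Qed.
Lemma im_partR t X : im_part (t *:_R X) = t *:_R im_part X.
Proof. by rewrite !im_partE (antilinR aD) -rscalerB rscaleA mulrC -rscaleA rscalerN rscaleC. Qed.
Lemma re_part_i X : re_part ('i *: X) = - im_part X.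
Proof. by rewrite !im_partE opprK !re_partE (antilin_i aD) -scalerBr rscaleC. Qed.
Lemma im_part_i X : im_part ('i *: X) = re_part X.
Proof. by rewrite im_partE re_partE (antilin_i aD) opprK -scalerDr rscaleC i_sq opprK. Qed.
Lemma re_part_conj X : re_part (D X) = re_part X.
Proof. by rewrite !re_partE DK addrC. Qed.
Lemma im_part_conj X : im_part (D X) = - im_part X.
Proof. by rewrite !im_partE DK -(opprB X) rscalerN scalerN. Qed.

Lemma ip_sym X Y : W X -> W Y -> ip X Y = ip Y X.
Proof. by have [_ h _] := hip; exact: h. Qed.
Lemma ipDl X Y Z : W X -> W Y -> W Z -> ip (X + Y) Z = ip X Z + ip Y Z.
Proof. by have [h _ _] := hip => a b c; have := h 1 X Y Z a b c; rewrite rscale1 mul1r. Qed.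
Lemma ip0l Z : W Z -> ip 0 Z = 0.
Proof.
move=> c; have := ipDl W_zero W_zero c; rewrite addr0 => h.
by apply: (addrI (ip 0 Z)); rewrite addr0 -h.
Qed.
Lemma ipZl a X Z : W X -> W Z -> ip (a *:_R X) Z = a * ip X Z.
Proof.
by have [h _ _] := hip => b c; have := h a X 0 Z b W_zero c; rewrite addr0 (ip0l c) addr0.
Qed.
Lemma ipNl X Z : W X -> W Z -> ip (- X) Z = - ip X Z.
Proof. by move=> b c; rewrite -(rscale1 X) -rscaleN ipZl // rscale1 mulN1r. Qed.
Lemma ipDr X Y Z : W X -> W Y -> W Z -> ip Z (X + Y) = ip Z X + ip Z Y.
Proof. by move=> a b c; rewrite !(ip_sym c) //; [exact: ipDl|exact: W_add]. Qed.
Lemma ipNr X Z : W X -> W Z -> ip Z (- X) = - ip Z X.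
Proof. by move=> a c; rewrite !(ip_sym c) //; [exact: ipNl|exact: W_opp]. Qed.
Lemma ip_ge0 X : W X -> 0 <= ip X X.
Proof.
move=> a; have [_ _ h] := hip; have [->|X0] := eqVneq X 0; first by rewrite ip0l //; exact: W_zero.
by apply/ltW/h.
Qed.
Lemma ip_eq0 X : W X -> ip X X = 0 -> X = 0.
Proof.
move=> a E; have [_ _ h] := hip; have [//|X0] := eqVneq X 0.
by have := h X a X0; rewrite E ltxx.
Qed.

Definition ipC (X Y : V) : Cplx R :=
  Complex (ip (re_part X) (re_part Y) - ip (im_part X) (im_part Y))
          (ip (re_part X) (im_part Y) + ip (im_part X) (re_part Y)).

Lemma ipC_sym X Y : ipC X Y = ipC Y X.
Proof.
rewrite /ipC (ip_sym (W_re_part X) (W_re_part Y)) (ip_sym (W_im_part X) (W_im_part Y)).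
by rewrite (ip_sym (W_re_part X) (W_im_part Y)) (ip_sym (W_im_part X) (W_re_part Y)) [X in Complex _ X]addrC.
Qed.

Lemma ipC_real X Y : W X -> W Y -> ipC X Y = (ip X Y)%:C.
Proof.
move=> a b; rewrite /ipC !re_part_id // !im_part_id // !ip0l //; try exact: W_zero.
by rewrite (ip_sym a W_zero) ip0l // subr0 addr0.
Qed.

Lemma ipCDl X Y Z : ipC (X + Y) Z = ipC X Z + ipC Y Z.
Proof.
rewrite /ipC re_partD im_partD !ipDl; try exact: W_re_part; try exact: W_im_part.
apply/eqP; rewrite eq_complex /=; apply/andP; split; apply/eqP; ring.
Qed.

Lemma ipCRl t X Z : ipC (t *:_R X) Z = t%:C * ipC X Z.
Proof.
rewrite /ipC re_partR im_partR !ipZl; try exact: W_re_part; try exact: W_im_part.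
apply/eqP; rewrite eq_complex /=; apply/andP; split; apply/eqP; ring.
Qed.

Lemma ipCil X Z : ipC ('i *: X) Z = 'i * ipC X Z.
Proof.
rewrite /ipC re_part_i im_part_i !ipNl; try exact: W_re_part; try exact: W_im_part.
apply/eqP; rewrite eq_complex /=; apply/andP; split; apply/eqP; ring.
Qed.

Lemma complex_split (k : Cplx R) : k = (complex.Re k)%:C + 'i * (complex.Im k)%:C.
Proof.
case: k => a b; apply/eqP; rewrite eq_complex /=; apply/andP; split; apply/eqP; ring.
Qed.

Lemma ipC_linear Z : linear (fun X => ipC X Z : (Cplx R)^o).
Proof.
move=> k X Y; rewrite ipCDl; congr (_ + _).
rewrite [k]complex_split scalerDl ipCDl -scalerA ipCil -!/(real_scale _ _) !ipCRl.
by rewrite /GRing.scale /= mulrDl mulrA.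
Qed.

(** [ipC (D Z) Z] is the sum of the squared norms of both parts of [Z]. *)
Lemma ipC_nondeg Z : ipC (D Z) Z = 0 -> Z = 0.
Proof.
move/eqP; rewrite eq_complex /= => /andP[/eqP h _].
rewrite re_part_conj im_part_conj ipNl in h; try exact: W_im_part.
rewrite opprK in h.
have h1 := ip_ge0 (W_re_part Z); have h2 := ip_ge0 (W_im_part Z).
have rz : re_part Z = 0 by apply: ip_eq0; [exact: W_re_part|lra].
have jz : im_part Z = 0 by apply: ip_eq0; [exact: W_im_part|lra].
by rewrite (re_im_part Z) rz jz scaler0 addr0.
Qed.

Lemma lin_rowE (E : lmodType (Cplx R)) (f : V -> E) : linear f ->
  forall Y, f Y = \sum_j Y 0 j *: f (delta_mx 0 j).
Proof.
move=> lf Y; rewrite [in LHS](row_sum_delta Y) (big_morph f (linD lf) (lin0 lf)).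
by apply: eq_bigr => j _; rewrite (linZ lf).
Qed.

Definition gram : 'M[Cplx R]_n := \matrix_(j, k) ipC (delta_mx 0 j) (delta_mx 0 k).

Lemma ipCE X Y : ipC X Y = \sum_k (X *m gram) 0 k * Y 0 k.
Proof.
rewrite ipC_sym (lin_rowE (ipC_linear X)); apply: eq_bigr => k _.
rewrite mulrC; congr (_ * _).
rewrite ipC_sym (lin_rowE (ipC_linear _)) mxE; apply: eq_bigr => j _.
by rewrite !mxE.
Qed.

Lemma gram_unit : gram \in unitmx.
Proof.
rewrite -row_free_unit -kermx_eq0; apply/rowV0P => u /sub_kermxP uA.
apply: ipC_nondeg; rewrite ipC_sym ipCE uA big1 // => k _.
by rewrite mxE mul0r.
Qed.

Lemma ipC_riesz (L : V -> (Cplx R)^o) : linear L -> exists Z, forall Y, L Y = ipC Y Z.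
Proof.
move=> lL; exists (\row_j L (delta_mx 0 j) *m invmx gram) => Y.
rewrite ipC_sym ipCE mulmxKV ?gram_unit // (lin_rowE lL).
by apply: eq_bigr => k _; rewrite mxE mulrC.
Qed.

Lemma ipC_inj Z Z' : (forall Y, ipC Y Z = ipC Y Z') -> Z = Z'.
Proof.
move=> h; apply/eqP; rewrite -subr_eq0; apply/eqP; apply: ipC_nondeg.
rewrite ipC_sym (linB (ipC_linear _)) !(ipC_sym _ (D _)) h subrr //.
Qed.

Lemma ipC_invariant (A : V -> V) : linear A -> (forall X, D (A X) = A (D X)) ->
  (forall X Y, W X -> W Y -> ip (A X) (A Y) = ip X Y) ->
  forall X Y, ipC (A X) (A Y) = ipC X Y.
Proof.
move=> lA AD h X Y.
have rA Z : re_part (A Z) = A (re_part Z) by rewrite !re_partE AD -(linD lA) (linR lA).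
have jA Z : im_part (A Z) = A (im_part Z).
  by rewrite !im_partE AD -(linB lA) -(linR lA) -(linZ lA) -(linN lA).
by rewrite /ipC !rA !jA !h //; try exact: W_re_part; try exact: W_im_part.
Qed.

Lemma cvg_ipC (T : Type) (F : set_system T) {FF : Filter F} (u v : T -> V) X Y :
  u x @[x --> F] --> X -> v x @[x --> F] --> Y ->
  ipC (u x) (v x) @[x --> F] --> ipC X Y.
Proof.
move=> hu hv; rewrite ipCE.
have -> : (fun x => ipC (u x) (v x)) = fun x => \sum_k (u x *m gram) 0 k * (v x) 0 k.
  by apply/funext => x; rewrite ipCE.
have cg : continuous (mulmxr gram : V -> V) by exact: rV_linear_continuous.
apply: (@cvg_big _ _ +%R) => // [|k _]; first exact: add_continuous.
apply: cvgM.
  apply: (cvg_comp (fun x => u x *m gram) (fun y : V => y 0 k)); last exact: coord_continuous.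
  exact: (cvg_comp u (mulmxr gram) hu (cg X)).
exact: (cvg_comp v (fun y : V => y 0 k) hv (@coord_continuous _ _ _ 0 k Y)).
Qed.

End ComplexForm.

(** * The derivative of the Kempf-Ness function *)

Section Polar.
Variables (R : realType) (n : nat) (G : complexLieGroupType R n).
Local Notation V := 'rV[Cplx R]_n.
Variables (e : V -> G) (U : set G) (delta : G -> G) (D : V -> V) (ip : V -> V -> R).
Hypotheses (he : is_exponential e) (hU : subgroup U)
  (hc : cartan_decomposition e U) (dM : group_morphism delta)
  (dI : involutive delta) (dfix : fixed delta = U) (dT : tangent_map delta D)
  (aD : antilinear D)
  (hip : inner_product_on (Lie e U) ip)
  (hipU : forall u, U u -> invariant_on (Lie e U) ip (adj u)).
Local Notation J := (dexp he).
Local Notation uu := (Lie e U).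
Local Notation atl := (@atlas R n G).
Local Notation c1 := (@chart1 R n G).
Local Notation B := (ipC D ip).

Let WD X : uu X <-> D X = X := Lie_compactP he dM dfix dT X.
Let DDK : involutive D := DK he dM dI dT.
Let B_linear Z : linear (fun X => B X Z : (Cplx R)^o) := ipC_linear DDK aD WD hip Z.

Lemma ipC_adj u X Y : U u -> B (adj u X) (adj u Y) = B X Y.
Proof.
move=> Uu; apply: (ipC_invariant DDK aD WD (adj_linear u)); last by move=> X1 X2; exact: hipU.
by move=> X1; exact: (adj_U he dM dfix dT).
Qed.

(** The functional [<T ., eta>] is represented by a vector [eta'], which is again fixed by
    the group [Ad(exp(t eta))].  So [w = eta - eta'] and its conjugate [D w] commute
    with [eta] and are fixed by [T], whence [<D w, w> = <D w, eta> - <T (D w), eta> = 0]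
    and [w = 0]. *)
Lemma invariant_functional eta (T : V -> V) : uu eta -> linear T ->
  (forall (t : R) X, T (adj (e (t *:_R eta)) X) = adj (e (t *:_R eta)) (T X)) ->
  (forall w, commutes e eta w -> T w = w) ->
  forall Y, B (T Y) eta = B Y eta.
Proof.
move=> ueta lT TB Tfix.
have lL : linear (fun Y => B (T Y) eta : (Cplx R)^o).
  by move=> k X Y; rewrite lT; exact: B_linear.
have [eta' hL] := ipC_riesz DDK aD WD hip lL.
have inv (t : R) Y : adj (e (t *:_R eta)) (adj (e ((- t) *:_R eta)) Y) = Y.
  by rewrite -(adj_mulg he) -(exp_rscaleD he) subrr rscale0 (exp_zero he) (adj_one he).
have Uexp (t : R) : U (e (t *:_R eta)) by exact: ueta.
have ceta : commutes e eta eta by exact: (commutes_self he).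
have c' : commutes e eta eta'.
  move=> t; apply: (ipC_inj DDK aD WD hip) => Y.
  rewrite -[in LHS](inv t Y) ipC_adj // -hL TB.
  rewrite -(ipC_adj _ _ (Uexp t)) inv ceta; exact: hL.
pose w := eta - eta'.
have cw : commutes e eta w by move=> t; rewrite (linB (adj_linear _)) ceta c'.
have cDw : commutes e eta (D w).
  by move=> t; rewrite -(adj_U he dM dfix dT) // cw.
have w0 : w = 0.
  apply: (ipC_nondeg DDK aD WD hip).
  rewrite (ipC_sym DDK aD WD hip) (linB (B_linear _)).
  by rewrite !(ipC_sym DDK aD WD hip _ (D w)) -hL (Tfix _ cDw) subrr.
move=> Y; rewrite [LHS]hL; congr (B _ _); apply/esym/eqP.
by rewrite -subr_eq0 -/w w0.
Qed.

Lemma functional_adj eta c Y : uu eta -> B (adj (e (c *: eta)) Y) eta = B Y eta.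
Proof.
move=> ueta; apply: invariant_functional => // [|t X|w cw]; first exact: adj_linear.
  rewrite -!(adj_mulg he); congr (adj _ _).
  have /(commutesZ c) /(_ t) /(adj_fixP he) /(_ 1) := commutes_self he eta.
  by rewrite rscale1 => ->.
apply: (commutes1 (e := e)); apply: (commutes_sym he); apply: commutesZ.
exact: (commutes_sym he).
Qed.

Lemma functional_dexp eta c Y : uu eta -> B (J (c *: eta) Y) eta = B Y eta.
Proof.
move=> ueta; apply: invariant_functional => // [|t X|w cw]; first exact: dexp_linear.
  by apply: dexp_adj; exact: (commutesZ c (commutes_self he eta)).
apply: dexp_commutes; apply: (commutes_sym he); apply: commutesZ.
exact: (commutes_sym he).
Qed.

Lemma rho_polar (k : G -> G) (p : G -> V) :
  (forall x, [/\ U (k x), uu (p x) & x = (k x * e ('i *: p x))%g]) ->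
  forall y, rho e U ip y = 2^-1 * ip (p y) (p y).
Proof.
move=> hk y; rewrite /rho; set P := [set X | _].
have [Uk up yE] := hk y.
have Pp : P (p y) by split => //; exists (k y).
have [ug [u Uu yE']] : P (get P) := getPex (ex_intro _ _ Pp).
have [_ ->] := cartan_unique hc Uu Uk ug up (etrans (esym yE') yE).
by [].
Qed.

Lemma dexp_of_diff b X Y : atl b -> cdom b (e X) ->
  'd (cfwd b \o e) X Y = 0 -> J X Y = 0.
Proof.
move=> Ab bX dY.
have lc : {for 0, continuous (fun t : R => X + t *:_R Y)} by exact: cvg_line.
have l0 : X + 0 *:_R Y = X by rewrite rscale0 addr0.
have [c' h2] := chart_exp_curve he Ab bX l0 lc (@has_der_line R V X Y).
rewrite dY in h2.
have c11 : cdom c1 (e (- X) * e X)%g by rewrite (exp_opp he) mulVg; exact: chart1_at1.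
have [L lL hL] := left_curve Ab (atlas_chart1 G) bX c11.
have e0 : (e \o (fun t : R => X + t *:_R Y)) 0 = e X by rewrite /= l0.
have [_ h1] := hL _ _ e0 c' h2.
rewrite (lin0 lL) in h1.
have [_ _ h3] := velocity_dexp_line he X Y.
exact: has_der_unique h3 h1.
Qed.

(** In a chart at [exp X], the curve [exp (v t)] is differentiable and the differential of
    [exp] at [X] is injective, so [has_der_inv] applies. *)
Lemma exp_lift X (v : R -> V) w : (forall Y, J X Y = 0 -> Y = 0) ->
  v 0 = X -> {for 0, continuous v} ->
  velocity (fun t => (e (- X) * e (v t))%g) w ->
  exists2 Y, has_der v Y & J X Y = w.
Proof.
move=> inj v0 cv cw.
have [b Ab bX] := atlas_cover (e X).
have bX1 : cdom b (e X * 1)%g by rewrite mulg1.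
have [L lL hL] := left_curve (atlas_chart1 G) Ab (chart1_at1 G) bX1.
have [w0 wc hw] := cw.
have [_ h1] := hL _ _ w0 wc hw.
have E : (fun t : R => cfwd b (e X * (e (- X) * e (v t)))%g) = (cfwd b \o e) \o v.
  by apply/funext => t; rewrite (exp_opp he) mulVKg.
rewrite E in h1.
have df : differentiable (cfwd b \o e) (v 0) by rewrite v0; exact: exp_diff.
have injD : injective ('d (cfwd b \o e) (v 0)).
  rewrite v0 => Y Z YZ; apply/eqP; rewrite -subr_eq0; apply/eqP; apply: inj.
  by apply: (dexp_of_diff Ab bX); rewrite linearB YZ subrr.
have [Y hY _] := has_der_inv df injD cv h1.
exists Y => //; apply: velocity_unique cw.
exact: velocity_dexp.
Qed.

Lemma delta_exp_i t X : uu X -> delta (e (t *:_R ('i *: X))) = (e (t *:_R ('i *: X)))^-1%g.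
Proof.
move=> uX; rewrite -(exp_rscaleN he) -(D_i he dM dfix dT aD uX).
exact: (morphism_expR he dM dT).
Qed.

Lemma deltaV x : delta x^-1%g = (delta x)^-1%g.
Proof.
apply/esym/mulg1_eq; rewrite -dM mulgV.
by apply: (mulgI (delta 1%g)); rewrite -dM !mulg1.
Qed.

(** With [y = z k a z'], [a = exp(i eta)], the element [delta(y)^-1 y] equals
    [z' a k^-1 z z k a z'].  Multiplying by [a^-2] on the left gives a product of
    conjugates of [z'], [z z] and [z'], whose velocities add up; the conjugations by
    [a] disappear after pairing with [eta]. *)
Lemma velocity_polar k X z z' (eta zeta zeta' : V) :
  z = (fun t : R => e (t *:_R ('i *: zeta))) ->
  z' = (fun t : R => e (t *:_R (- ('i *: zeta')))) ->
  X = 2 *:_R ('i *: eta) ->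
  uu eta -> uu zeta -> uu zeta' -> U k ->
  exists2 w,
   velocity (fun t => (e (- X) *
     ((delta (z t * (k * e ('i *: eta)) * z' t))^-1 *
      (z t * (k * e ('i *: eta)) * z' t)))%g) w &
   B w eta = 2 * ('i * B (adj k^-1%g zeta) eta) - 2 * ('i * B zeta' eta).
Proof.
move=> zE z'E XE ueta uz uz' Uk.
set a := e ('i *: eta).
have cz : velocity z ('i *: zeta) by rewrite zE; exact: velocity_exp.
have cz' : velocity z' (- ('i *: zeta')) by rewrite z'E; exact: velocity_exp.
exists (adj (a^-1 * a^-1)%g (- ('i *: zeta')) +
   adj (a^-1 * k^-1)%g ('i *: zeta + 'i *: zeta) + - ('i *: zeta')).
  have c1' := adj_tangent (a^-1 * a^-1)%g cz'.
  have c2' := adj_tangent (a^-1 * k^-1)%g (velocity_mul cz cz).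
  have := velocity_mul (velocity_mul c1' c2') cz'.
  set f1 := (F in velocity F _); set f2 := (F in _ -> velocity F _).
  suff -> : f2 = f1 by [].
  apply/funext => t; rewrite /f1 /f2 /= /conj_by.
  have da : delta a = a^-1%g by have := delta_exp_i 1 ueta; rewrite rscale1.
  have dz : delta (z t) = (z t)^-1%g by rewrite zE; exact: delta_exp_i.
  have dz' : delta (z' t) = (z' t)^-1%g.
    by rewrite z'E /= (exp_rscaleN he) deltaV (delta_exp_i t uz').
  have dk : delta k = k by apply/(delta_U dfix).
  rewrite !dM dz dz' dk da grp_inv_polar.
  have -> : e (- X) = (a^-1 * a^-1)%g.
    by rewrite (exp_opp he) XE (exp2 he) invgM.
  exact: grp_polar.
have aE : a^-1%g = e ((- 'i) *: eta) by rewrite /a -(exp_opp he) scaleNr.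
have ea Y : B (adj a^-1%g Y) eta = B Y eta by rewrite aE; exact: functional_adj.
have Bi Y : B ('i *: Y) eta = 'i * B Y eta := linZ (B_linear eta) _ _.
have BN Y : B (- Y) eta = - B Y eta := linN (B_linear eta) _.
rewrite !(linD (B_linear eta)) !(adj_mulg he) !ea !BN !Bi.
rewrite (linD (adj_linear _)) (linD (B_linear eta)) !(linZ (adj_linear _)) !Bi.
by ring.
Qed.

Lemma mul_cont (f g : R -> G) : {for 0, continuous f} -> {for 0, continuous g} ->
  {for 0, continuous (fun t => (f t * g t)%g)}.
Proof.
move=> cf cg; have [cm _] := @lie_mul_holo R n G.
apply: (@continuous_comp _ _ _ (fun t => (f t, g t)) (fun p : G * G => (p.1 * p.2)%g)); last exact: cm.
by apply: cvg_pair; [exact: cf|exact: cg].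
Qed.

(** The difference quotient of [<q, q> / 2] is [<diff_quot q, q t + q 0> / 2]. *)
Lemma half_ip_derivative (q : R -> V) Y : (forall t, uu (q t)) ->
  {for 0, continuous q} -> has_der q Y ->
  derive1 (fun t => 2^-1 * ip (q t) (q t)) 0 = ReC (B Y (q 0)).
Proof.
move=> uq cq hq; rewrite /derive1; apply: cvg_lim => //.
have h1 : q t + q 0 @[t --> 0^'] --> q 0 + q 0.
  apply: cvgD; last exact: cvg_cst.
  exact: has_der_cvg hq.
have h2 := cvg_ipC DDK aD WD hip hq h1.
have h3 : ReC (B (diff_quot q t) (q t + q 0)) @[t --> 0^'] --> ReC (B Y (q 0 + q 0)).
  apply: (cvg_comp (fun t => B (diff_quot q t) (q t + q 0)) (@ReC R)); first exact: h2.
  exact: cvg_Re.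
have h4 : (2^-1 * ReC (B (diff_quot q t) (q t + q 0))) @[t --> 0^'] --> 2^-1 * ReC (B Y (q 0 + q 0)).
  by apply: cvgM => //; exact: cvg_cst.
have E : 2^-1 * ReC (B Y (q 0 + q 0)) = ReC (B Y (q 0)).
  rewrite (ipC_sym DDK aD WD hip) (linD (B_linear Y)) (ipC_sym DDK aD WD hip).
  by case: (B Y (q 0)) => x y; rewrite /ReC /=; field.
rewrite -E; apply: cvg_trans h4; apply: near_eq_cvg; near=> t.
have uqt : uu (diff_quot q t) by apply: (uuR (e := e)); apply: (uuD he dM dfix dT aD) => //; exact: (uuN he dM dfix dT aD).
have us : uu (q t + q 0) by exact: (uuD he dM dfix dT aD).
rewrite (ipC_real aD WD hip uqt us) /ReC /= addr0.
rewrite /diff_quot (ipZl aD WD hip _ _ us); last by apply: (uuD he dM dfix dT aD) => //; exact: (uuN he dM dfix dT aD).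
rewrite (ipDl hip (uq t) (uuN he dM dfix dT aD (uq 0)) us) (ipNl aD WD hip (uq 0) us).
rewrite !(ipDr aD WD hip) // (ip_sym hip (uq 0) (uq t)) /GRing.scale /=.
by ring.
Unshelve. all: by end_near. Qed.

(** The curve [v = 2i q], where [q] is the noncompact component, is a differentiable lift by
    [exp_lift]; pairing [J X (v' 0)] with [eta] gives [v' 0] paired with [eta] by
    [functional_dexp], and [velocity_polar] computes the same number. *)
Lemma rho_derivative k (eta zeta zeta' : V) : uu eta -> uu zeta -> uu zeta' -> U k ->
  derive1 (fun t : R => rho e U ip
     (e (t *:_R ('i *: zeta)) * (k * e ('i *: eta)) * e (- (t *:_R ('i *: zeta'))))%g) 0
  = ip (adj k^-1%g zeta) eta - ip zeta' eta.
Proof.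
move=> ueta uz uz' Uk.
have [kk [p [ckk cp hpol hinv]]] := hc.
pose x := (k * e ('i *: eta))%g.
have [z zE] : exists z, z = (fun t : R => e (t *:_R ('i *: zeta))) by eexists.
have [z' z'E] : exists z', z' = (fun t : R => e (t *:_R (- ('i *: zeta')))) by eexists.
pose g t := (z t * x * z' t)%g.
have [z0 zc _] : velocity z ('i *: zeta) by rewrite zE; exact: velocity_exp.
have [z0' zc' _] : velocity z' (- ('i *: zeta')) by rewrite z'E; exact: velocity_exp.
have g0 : g 0 = x by rewrite /g z0 z0' mul1g mulg1.
have cg : {for 0, continuous g}.
  apply: mul_cont => //; apply: mul_cont => //; exact: cvg_cst.
pose q t := p (g t).
have cq : {for 0, continuous q} by apply: continuous_comp; [exact: cg|exact: cp].
have uq t : uu (q t) by have [] := hpol (g t).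
have q0 : q 0 = eta by rewrite /q g0; have [] := hinv k eta Uk ueta.
have -> : (fun t : R => rho e U ip
     (e (t *:_R ('i *: zeta)) * (k * e ('i *: eta)) * e (- (t *:_R ('i *: zeta'))))%g) =
   fun t => 2^-1 * ip (q t) (q t).
  apply/funext => t; rewrite -(rho_polar hpol) /q /g zE z'E /=.
  by rewrite rscalerN.
pose c : Cplx R := 2%:R * 'i.
have cE Y : 2 *:_R ('i *: Y) = c *: Y by rewrite /real_scale scalerA rmorph_nat.
have c0 : c != 0.
  by rewrite mulf_neq0 ?pnatr_eq0 // eq_complex /= oner_eq0 andbF.
have cK (Y : V) : c^-1 *: (c *: Y) = Y by rewrite scalerA mulVf // scale1r.
pose X : V := 2 *:_R ('i *: eta).
pose v t : V := 2 *:_R ('i *: q t).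
have v0 : v 0 = X by rewrite /v q0.
have cv : {for 0, continuous v}.
  have h : {for 0, continuous (fun t => c *: q t)} by apply: cvgZ; [exact: cvg_cst|exact: cq].
  have -> : v = fun t => c *: q t by apply/funext => t; rewrite /v cE.
  exact: h.
have [w cw Bw] := velocity_polar zE z'E (erefl X) ueta uz uz' Uk.
have ev t : e (v t) = ((delta (g t))^-1 * g t)%g.
  have [Uy uy yE] := hpol (g t).
  have dy : delta (g t) = (kk (g t) * (e ('i *: q t))^-1)%g.
    rewrite {1}yE dM; congr (_ * _)%g; first exact/(delta_U dfix).
    by have := delta_exp_i 1 uy; rewrite rscale1.
  by rewrite dy {2}yE grp_sq_polar /v (exp2 he).
have cw' : velocity (fun t => (e (- X) * e (v t))%g) w.
  have -> : (fun t => (e (- X) * e (v t))%g) =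
    (fun t => (e (- X) * ((delta (z t * (k * e ('i *: eta)) * z' t))^-1 *
                          (z t * (k * e ('i *: eta)) * z' t)))%g).
    by apply/funext => t; rewrite ev.
  exact: cw.
have XE : X = 'i *: (2 *:_R eta) by exact: rscaleC.
have inj Y : J X Y = 0 -> Y = 0.
  rewrite XE; apply: (dexp_inj hU hc dM dI dfix dT aD); exact: uuR.
have [Y hY JY] := exp_lift inj v0 cv cw'.
have BY : B Y eta = c * ((ip (adj k^-1%g zeta) eta)%:C - (ip zeta' eta)%:C).
  have Uk' : U k^-1%g by case: hU => _ _; apply.
  rewrite -(ipC_real aD WD hip uz' ueta).
  rewrite -(ipC_real aD WD hip (uu_adj he dM dfix dT Uk' uz) ueta).
  rewrite -(functional_dexp c Y ueta) -cE JY Bw /c; ring.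
have hq : has_der q (c^-1 *: Y).
  have lc : continuous ( *:%R c^-1 : V -> V) by exact: rV_linear_continuous.
  have := has_der_linear lc hY.
  have -> : ( *:%R c^-1 : V -> V) \o v = q.
    by apply/funext => t; rewrite /= /v cE cK.
  by [].
rewrite (half_ip_derivative uq cq hq) q0.
have -> : B (c^-1 *: Y) eta = c^-1 * B Y eta by exact: (linZ (B_linear eta)).
by rewrite BY mulKf // -rmorphB.
Qed.

End Polar.

(** * The Kempf-Ness set *)

Section KempfNess.
Variables (R : realType) (n : nat) (UC : complexLieGroupType R n).
Local Notation V := 'rV[Cplx R]_n.
Variables (e : V -> UC) (U : set UC) (phi sigma theta delta : UC -> UC)
  (F S T D : V -> V) (ip : V -> V -> R).
Hypotheses (he : is_exponential e) (hU : subgroup U)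
  (hc : cartan_decomposition e U).
Hypotheses (dM : group_morphism delta) (dI : involutive delta)
  (dfix : fixed delta = U) (dT : tangent_map delta D)
  (aD : antilinear D).
Hypotheses (phiM : group_morphism phi) (phiT : tangent_map phi F)
  (aF : antilinear F)
  (phiU : forall u, U u -> U (phi u)).
Hypotheses (sM : group_morphism sigma) (sI : involutive sigma) (sT : tangent_map sigma S)
  (lS : linear S).
Hypotheses (tM : group_morphism theta) (tI : involutive theta) (tT : tangent_map theta T)
  (lT : linear T).
Hypotheses (sp : sigma \o phi = phi \o sigma) (tp : theta \o phi = phi \o theta)
  (ds : delta \o sigma = sigma \o delta) (dt : delta \o theta = theta \o delta)
  (dp : delta \o phi = phi \o delta).
Hypotheses (hip : inner_product_on (Lie e U) ip)
  (hipU : forall u, U u -> invariant_on (Lie e U) ip (adj u))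
  (hipS : invariant_on (Lie e U) ip S) (hipT : invariant_on (Lie e U) ip T).
Local Notation uu := (Lie e U).

Let UM x y : U x -> U y -> U (x * y)%g. Proof. by case: hU => _ h _; exact: h. Qed.
Let UV x : U x -> U x^-1%g. Proof. by case: hU => _ _; apply. Qed.
Let U1 : U 1%g. Proof. by case: hU. Qed.
Let uP X : uu X <-> D X = X := Lie_compactP he dM dfix dT X.

Lemma theta_U u : U u -> U (theta u).
Proof.
move=> /(delta_U dfix) du; apply/(delta_U dfix).
by rewrite -[LHS]/((delta \o theta) u) dt /= du.
Qed.

Lemma uu_T X : uu X -> uu (T X).
Proof. by move=> /uP h; apply/uP; rewrite (tangent_commute dT tT dt) h. Qed.
Lemma uu_S X : uu X -> uu (S X).
Proof. by move=> /uP h; apply/uP; rewrite (tangent_commute dT sT ds) h. Qed.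
Lemma uu_F X : uu X -> uu (F X).
Proof. by move=> /uP h; apply/uP; rewrite (tangent_commute dT phiT dp) h. Qed.

Let TK : involutive T := DK he tM tI tT.
Let SK : involutive S := DK he sM sI sT.

(** [phi] preserves [U] and is antilinear, so [exp(i eta)] goes to [exp(i (- F eta))]. *)
Lemma phi_polar k eta : U k -> uu eta ->
  phi (k * e ('i *: eta))%g = (k * e ('i *: eta))%g -> phi k = k /\ F eta = - eta.
Proof.
move=> Uk ueta; rewrite phiM (morphism_exp he phiM phiT) (antilin_i aF) -scalerN => E.
have uF : uu (- F eta) by apply: (uuN he dM dfix dT aD); exact: uu_F.
have [-> h] := cartan_unique hc (phiU Uk) Uk uF ueta E.
by split => //; rewrite -[LHS]opprK h.
Qed.

(** For [u exp(i eta)] with [T etaL = - eta], the second term of [rho_derivative] is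
    [- <T zeta, eta> = <T zeta, T etaL>], which equals the first one. *)
Lemma moment_value u etaL zeta : U u -> uu etaL -> uu zeta ->
  T etaL = - adj u^-1%g etaL ->
  moment e U ip theta (e ('i *: etaL) * u)%g zeta = 2 * ip zeta etaL.
Proof.
move=> Uu uL uz TL; pose eta := adj u^-1%g etaL.
have ueta : uu eta by apply: (uu_adj he dM dfix dT) => //; exact: UV.
have adeta : adj u eta = etaL by rewrite /eta -(adj_mulg he) mulgV (adj_one he).
have -> : (e ('i *: etaL) * u)%g = (u * e ('i *: eta))%g.
  by rewrite (exp_adj he) (linZ (adj_linear u)) adeta.
rewrite /moment (tangent_mapE tT).
have -> := rho_derivative he hU hc dM dI dfix dT aD hip hipU ueta uz (uu_T uz) Uu.
have <- : ip zeta etaL = ip (adj u^-1%g zeta) eta.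
  by rewrite -{1}adeta -(hipU (UV Uu) uz (uu_adj he dM dfix dT Uu ueta)) -(adj_mulg he) mulVg (adj_one he).
have -> : eta = - T etaL by rewrite TL opprK.
rewrite (ipNr aD uP hip) ?hipT //; [ring|exact: uu_T|exact: uu_T].
Qed.

(** The twisted action of [exp(s xi)] multiplies [exp(r xi) u] by [exp(s xi)] on the left and
    by [exp(- s T xi)] on the right; moving the latter across [u] produces another
    [exp(s xi)]. *)
Lemma twist_shift u xi h (r s : R) : adj u (T xi) = - xi ->
  twisted_act theta h 1%g = (e (r *:_R xi) * u)%g ->
  twisted_act theta (e (s *:_R xi) * h)%g 1%g = (e ((s + r + s) *:_R xi) * u)%g.
Proof.
move=> Txi hh; rewrite /twisted_act tM (grp_twist (e (s *:_R xi))).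
rewrite -/(twisted_act theta h 1%g) hh (morphism_expR he tM tT) -(exp_rscaleN he).
have -> : ((e (s *:_R xi) * (e (r *:_R xi) * u)) * e (s *:_R - T xi) =
   (e (s *:_R xi) * e (r *:_R xi)) * (u * e (s *:_R - T xi)))%g by rewrite !mulgA.
have hu := exp_adj he u (s *:_R - T xi).
rewrite adjR (linN (adj_linear u)) Txi opprK in hu.
rewrite hu mulgA.
by rewrite (exp_rscaleD he xi (s + r) s) (exp_rscaleD he xi s r).
Qed.

(** The intersection of [X] and [U] is [X_0]: if [g = k exp(i eta)], then [u = g theta(g)^-1]
    reads [(k^-1 u theta(k)) exp(i T eta) = exp(i eta)], and the compact parts agree. *)
Lemma twist_compact u g : U u -> phi g = g -> u = twisted_act theta g 1%g ->
  exists k, [/\ U k, phi k = k & u = twisted_act theta k 1%g].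
Proof.
move=> Uu pg uE.
have [kk [p [_ _ hpol _]]] := hc; have [Uk up gE] := hpol g.
exists (kk g).
have [pk _] : phi (kk g) = kk g /\ F (p g) = - p g.
  by apply: phi_polar => //; rewrite -gE.
split => //; rewrite /twisted_act in uE *.
have E : theta g = (theta (kk g) * e ('i *: T (p g)))%g.
  by rewrite {1}gE tM (morphism_exp he tM tT) (linZ lT).
rewrite E {1}gE in uE; have := grp_twist_polar uE => E'.
have Uh : U ((kk g)^-1 * u * theta (kk g))%g.
  by apply: UM; [apply: UM => //; exact: UV|exact: theta_U].
have [h _] := cartan_unique hc Uh U1 (uu_T up) up E'.
exact: grp_twist_unit h.
Qed.

Lemma i_inv (Z : V) : 'i *: (- ('i *: Z)) = Z.
Proof. by rewrite scalerN i_sq opprK. Qed.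

Section RealGroups.
Variables (H : set UC).
Hypotheses (hH : subgroup H)
  (hHo : exists2 W : set UC, open W & H = (fixed phi `&` fixed sigma) `&` W).

(** [H] is open in the fixed group of [phi] and [sigma], so both have the same Lie algebra. *)
Lemma Lie_H X : Lie e H X <-> F X = X /\ S X = X.
Proof.
have [W oW HE] := hHo; split=> [hX|[FX SX]].
  split; [apply/(Lie_fixed he phiM phiT)|apply/(Lie_fixed he sM sT)] => t;
  by have := hX t; rewrite HE => -[[]].
apply: (Lie_near he hH).
have H1 : H 1%g by case: hH.
have W1 : W (e (0 *:_R X)) by rewrite rscale0 (exp_zero he); move: H1; rewrite HE => -[].
have [_ ec _] := velocity_exp he X.
have := near0_comp ec oW W1; apply: filterS => t Wt.
rewrite HE; split => //; split.
  by have /(Lie_fixed he phiM phiT) := FX; apply.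
by have /(Lie_fixed he sM sT) := SX; apply.
Qed.

Lemma kempf_ness_sub x : kempf_ness e U ip theta H (beta_image theta (fixed phi)) x ->
  exists u xi, [/\ beta_image theta (fixed phi `&` U) u,
     (minus_space e (fixed phi) sigma theta u `&` r0 e (fixed phi) delta) xi &
     x = (e xi * u)%g].
Proof.
move=> [[g pg gx] mom].
have [kk [p [_ _ hpol _]]] := hc; have [Uk ueta xE] := hpol x.
set k := kk x in Uk xE; set eta := p x in ueta xE.
have px : phi x = x.
  rewrite -gx /twisted_act !phiM (morphismV _ phiM) (morphism1 phiM) pg.
  by rewrite -[phi (theta g)]/((phi \o theta) g) -tp /= pg.
have tx : theta x = x^-1%g.
  by rewrite -gx /twisted_act !tM (morphismV _ tM) (morphism1 tM) tI grp_twist_inv.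
have [pk Feta] : phi k = k /\ F eta = - eta by apply: phi_polar => //; rewrite -xE.
have lA := adj_linear k.
pose etaL := adj k eta; pose xi := 'i *: etaL.
have uL : uu etaL by exact: (uu_adj he dM dfix dT).
have xE' : x = (e xi * k)%g by rewrite {1}xE (exp_adj he) (linZ lA).
have [tk Teta] : theta k = k^-1%g /\ T eta = - etaL.
  apply: (cartan_unique hc) => //; [exact: theta_U|exact: UV|exact: uu_T|exact: (uuN he dM dfix dT aD)|].
  have -> : (theta k * e ('i *: T eta))%g = theta x.
    by rewrite xE tM (morphism_exp he tM tT) (linZ lT).
  rewrite tx xE' invgM -(exp_opp he); congr (_ * e _)%g.
  by rewrite scalerN.
have TL : T etaL = - eta by rewrite -[eta]TK Teta (linN lT) opprK.
have aT : adj k (T xi) = - xi.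
  by rewrite /xi (linZ lT) TL scalerN (linN lA) (linZ lA).
have Fxi : F xi = xi.
  by rewrite /xi (antilin_i aF) /etaL (adj_delta he phiM phiT) pk Feta (linN lA) scalerN opprK.
have Dxi : D xi = - xi by exact: (D_i he dM dfix dT aD).
have Gxi : Lie e (fixed phi) xi by apply/(Lie_fixed he phiM phiT).
have FL : F etaL = - etaL by rewrite /etaL (adj_delta he phiM phiT) pk Feta (linN lA).
have kX : beta_image theta (fixed phi `&` U) k.
  have hg : twisted_act theta g 1%g = (e (1 *:_R xi) * k)%g by rewrite rscale1 -xE' gx.
  have := twist_shift (- 2^-1) aT hg.
  have -> : - 2^-1 + 1 - 2^-1 = 0 :> R by field.
  rewrite rscale0 (exp_zero he) mul1g => kE.
  have [|k0 [Uk0 pk0 k0E]] := twist_compact Uk _ (esym kE).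
    by rewrite phiM pg; have := Gxi (- 2^-1) => /= ->.
  by exists k0.
have TLk : T etaL = - adj k^-1%g etaL.
  by rewrite TL /etaL -(adj_mulg he) mulVg (adj_one he).
(* The test vector: the [sigma]-fixed part of [etaL], up to a factor 2. *)
pose zeta := etaL + S etaL.
have uz : uu zeta by apply: (uuD he dM dfix dT aD) => //; exact: uu_S.
have Sz : S zeta = zeta by rewrite /zeta (linD lS) SK addrC.
have Fz : F zeta = - zeta.
  by rewrite /zeta (antilinD aF) FL -(tangent_commute sT phiT sp) FL (linN lS) opprD.
have zH : i_Lie_meet e H U zeta.
  split => //; exists (- ('i *: zeta)); last exact: i_inv.
  apply/Lie_H; split.
    by rewrite (antilinN aF) (antilin_i aF) Fz scalerN !opprK.
  by rewrite (linN lS) (linZ lS) Sz.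
have uSL := uu_S uL.
have m0 : ip zeta etaL = 0.
  have := mom _ zH; rewrite xE' (moment_value Uk uL uz TLk) => /eqP.
  by rewrite mulf_eq0 pnatr_eq0 => /eqP.
have zz : zeta = 0.
  apply: (ip_eq0 hip uz); rewrite {2}/zeta (ipDr aD uP hip) // m0 add0r.
  by rewrite -{1}Sz hipS.
have SL : S etaL = - etaL by apply/eqP; rewrite -addr_eq0 addrC -/zeta zz.
exists k, xi; split => //; split; last first.
  by split => //; rewrite (tangent_mapE dT).
split => //.
  by rewrite (tangent_mapE (tangent_map_comp (adj_tangent k) tT)).
by rewrite (tangent_mapE sT) /xi (linZ lS) SL scalerN.
Qed.

Lemma kempf_ness_sup u xi : beta_image theta (fixed phi `&` U) u ->
  (minus_space e (fixed phi) sigma theta u `&` r0 e (fixed phi) delta) xi ->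
  kempf_ness e U ip theta H (beta_image theta (fixed phi)) (e xi * u)%g.
Proof.
move=> [k0 [pk0 Uk0] k0E] [[Gxi aT Sxi] [_ Dxi]].
rewrite (tangent_mapE (tangent_map_comp (adj_tangent u) tT)) /= in aT.
rewrite (tangent_mapE sT) in Sxi; rewrite (tangent_mapE dT) in Dxi.
have Uu : U u.
  rewrite -k0E /twisted_act mulg1; apply: UM => //; apply: UV; exact: theta_U.
split.
  exists (e (2^-1 *:_R xi) * k0)%g.
    by rewrite /fixed /= phiM pk0; have := Gxi (2^-1) => /= ->.
  have hg : twisted_act theta k0 1%g = (e (0 *:_R xi) * u)%g.
    by rewrite rscale0 (exp_zero he) mul1g.
  rewrite (twist_shift (2^-1) aT hg).
  have -> : 2^-1 + 0 + 2^-1 = 1 :> R by field.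
  by rewrite rscale1.
move=> zeta [[Z /Lie_H[_ SZ] Zz] uz].
pose etaL := - ('i *: xi).
have xiE : xi = 'i *: etaL by rewrite i_inv.
have uL : uu etaL by apply/uP; rewrite (antilinN aD) (antilin_i aD) Dxi scalerN !opprK.
have SL : S etaL = - etaL by rewrite (linN lS) (linZ lS) Sxi scalerN.
have Sz : S zeta = zeta by rewrite -Zz (linZ lS) SZ.
have TL : T etaL = - adj u^-1%g etaL.
  have E : adj u (T etaL) = - etaL.
    rewrite (linN lT) (linZ lT) (linN (adj_linear u)) (linZ (adj_linear u)).
    by rewrite aT scalerN.
  have := congr1 (adj u^-1%g) E.
  by rewrite -(adj_mulg he) mulVg (adj_one he) (linN (adj_linear _)).
rewrite xiE (moment_value Uu uL uz TL).
have h : ip zeta etaL = - ip zeta etaL.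
  by rewrite -{1}(hipS uz uL) Sz SL (ipNr aD uP hip).
lra.
Qed.

End RealGroups.

End KempfNess.

Theorem proposition5p1
  (R : realType) (n : nat) (UC : complexLieGroupType R n)
  (exp : 'rV[Cplx R]_n -> UC) (hexp : is_exponential exp)
  (U : set UC) (hUsub : subgroup U) (hUcompact : compact U)
  (hUconn : connected U)
  (hUC : is_complexification U) (hcartan : cartan_decomposition exp U)
  (phi sigma theta delta : UC -> UC)
  (hphi : involutive_automorphism phi)
  (hphi_anti : antiholomorphic (@atlas R n UC) (@atlas R n UC) phi)
  (hphiU : phi @` U = U)
  (hsigma : involutive_automorphism sigma)
  (hsigma_holo : holomorphic (@atlas R n UC) (@atlas R n UC) sigma)
  (htheta : involutive_automorphism theta)
  (htheta_holo : holomorphic (@atlas R n UC) (@atlas R n UC) theta)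
  (hsigma_phi : sigma \o phi = phi \o sigma)
  (htheta_phi : theta \o phi = phi \o theta)
  (hfin : generate_finite_group_on
            (identity_component (@group_center R n UC)) sigma theta)
  (hdelta : involutive_automorphism delta)
  (hdelta_anti : antiholomorphic (@atlas R n UC) (@atlas R n UC) delta)
  (hdelta_fix : fixed delta = U)
  (hdelta_sigma : delta \o sigma = sigma \o delta)
  (hdelta_theta : delta \o theta = theta \o delta)
  (hdelta_phi : delta \o phi = phi \o delta)
  (G : set UC) (hG : G = fixed phi)
  (H : set UC) (hHsub : subgroup H)
  (hHopen : exists2 W : set UC, open W & H = (G `&` fixed sigma) `&` W)
  (K : set UC) (hK : K = G `&` fixed theta)
  (hHGK : G = [set y : UC | exists h g k : UC,
                 [/\ H h, identity_component G g, K k & y = (h * g * k)%g]])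
  (ip : 'rV[Cplx R]_n -> 'rV[Cplx R]_n -> R)
  (hip : inner_product_on (Lie exp U) ip)
  (hipU : forall u, U u -> invariant_on (Lie exp U) ip (Ad u))
  (hip_sigma : invariant_on (Lie exp U) ip (lie_map sigma))
  (hip_theta : invariant_on (Lie exp U) ip (lie_map theta))
  (X X0 : set UC) (hX : X = beta_image theta G)
  (hX0 : X0 = beta_image theta (G `&` U)) :
  kempf_ness exp U ip theta H X =
  [set y : UC | exists u xi,
     [/\ X0 u,
         (minus_space exp G sigma theta u `&` r0 exp G delta) xi &
         y = (exp xi * u)%g]].
Proof.
have [dI dM] := hdelta; have [pI pM] := hphi.
have [sI sM] := hsigma; have [tI tM] := htheta.
have [D aD dT] := antiholo_tangent hdelta_anti (morphism1 dM).
have [F aF pT] := antiholo_tangent hphi_anti (morphism1 pM).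
have [S lS sT] := holo_tangent hsigma_holo (morphism1 sM).
have [T lT tT] := holo_tangent htheta_holo (morphism1 tM).
have pU u : U u -> U (phi u) by move=> Uu; rewrite -hphiU; exists u.
have hipA u : U u -> invariant_on (Lie exp U) ip (adj u) by rewrite -AdE; exact: hipU.
rewrite (tangent_mapE sT) in hip_sigma; rewrite (tangent_mapE tT) in hip_theta.
rewrite hX hX0; rewrite {K hK hHGK X X0 hX hX0 hipU}hG in hHopen *.
apply/seteqP; split=> [x hx|_ [u [xi [hu hxi ->]]]].
  exact: (kempf_ness_sub hexp hUsub hcartan dM dI hdelta_fix dT aD pM pT aF pU
    sM sI sT lS tM tI tT lT hsigma_phi htheta_phi hdelta_sigma hdelta_theta
    hdelta_phi hip hipA hip_sigma hip_theta hHsub hHopen hx).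
exact: (kempf_ness_sup hexp hUsub hcartan dM dI hdelta_fix dT aD pM pT sM sT lS
  tM tT lT hdelta_theta hip hipA hip_sigma hip_theta hHsub hHopen hu hxi).
Qed.
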